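(* Let $r\ge1$. For each $l=1,\ldots,r$ let $\nu^{0l}\in\mathbb C^{2n}$ be a common eigenvector of the matrices $A_k$ corresponding to the eigenvalues $\lambda_l^k$, $k=1,\ldots,2m$, and let $\nu^{\eta l}$, $\eta=1,\ldots,s_l-1$, be generalized eigenvectors of order $\eta$ of $A_\zeta$ corresponding to the eigenvalue $\lambda_l^\zeta$ with elementary divisor of multiplicity $s_l\ge2$. Assume $\sum_{l=1}^r s_l\ge 2m+1$. Let $\Psi_{\eta l}^\zeta\colon\Omega\to\mathbb C$, $\eta=1,\ldots,s_l-1$, be the solution of the system $$\nu^{\eta l}\gamma=\sum_{\delta=1}^{\eta}\binom{\eta-1}{\delta-1}\Psi_{\delta l}^\zeta(w)\,\nu^{\eta-\delta,l}\gamma,\quad \eta=1,\ldots,s_l-1,$$ on a domain $\Omega$ on which $\nu^{0l}\gamma\ne0$, $l=1,\ldots,r$. Assume that none of the functions $w\to\mathfrak x_k\Psi^\zeta_{\eta l}(w)$, $k=1,\ldots,2m$, $k\neq\zeta$, $\eta=1,\ldots,s_l-1$, $l=1,\ldots,r$, is a (nonconstant) first integral of the ordinary differential system $(1.1.\zeta)$ described in the context. Let $\mu_{\eta l}^{k\zeta}=\mathfrak x_k\Psi^\zeta_{\eta l}(w)$, $k=1,\ldots,2m$ (constants). Then the completely solvable system $dw=X_1(w)dz+X_2(w)d\overline z$ has the autonomous first integral $$F\colon w\to\prod_{\xi=1}^{\alpha}\bigl(\nu^{0\xi}\gamma\bigr)^{h_{0\xi}}\exp\sum_{q=1}^{\varepsilon_\xi}h_{q\xi}\Psi^\zeta_{q\xi}(w)\quad\text{for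 all }w\in\Omega,\quad\Omega\subset{\rm D}(F),$$ where $\sum_{\xi=1}^\alpha\varepsilon_\xi=2m-\alpha+1$, $\varepsilon_\xi\le s_\xi-1$, $\xi=1,\ldots,\alpha$, $\alpha\le r$, and $h_{q\xi}$, $q=0,\ldots,\varepsilon_\xi$, $\xi=1,\ldots,\alpha$, is a nontrivial solution of the linear homogeneous system $$\sum_{\xi=1}^{\alpha}\Bigl(\lambda_\xi^kh_{0\xi}+\sum_{q=1}^{\varepsilon_\xi}\mu_{q\xi}^{k\zeta}h_{q\xi}\Bigr)=0,\quad k=1,\ldots,2m.$$
   Context: Let $m,n\ge 1$, $w=(w_1,\ldots,w_n)\in\mathbb C^n$, $z=(z_1,\ldots,z_m)\in\mathbb C^m$, columns. Consider $dw=X_1(w)\,dz+X_2(w)\,d\overline z$, where $X_1(w)=\|X_{\tau j}(w)\|$, $X_2(w)=\|X_{\tau,m+j}(w)\|$ ($\tau=1,\ldots,n$, $j=1,\ldots,m$) and $X_{\tau k}(w)=\sum_{\xi=1}^n\bigl(a_{\tau k\xi}w_\xi+a_{\tau k,n+\xi}\overline w_\xi\bigr)$, $k=1,\ldots,2m$, with constants $a_{\tau k\varrho}\in\mathbb C$. The associated operators are, for $j=1,\ldots,m$, $$\mathfrak x_j(w)=\sum_{\xi=1}^n\bigl(X_{\xi j}(w)\partial_{w_\xi}+\overline{X_{\xi,m+j}(w)}\,\partial_{\overline w_\xi}\bigr),\qquad \mathfrak x_{m+j}(w)=\sum_{\xi=1}^n\bigl(X_{\xi,m+j}(w)\partial_{w_\xi}+\overline{X_{\xi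 j}(w)}\,\partial_{\overline w_\xi}\bigr).$$ The system is assumed completely solvable: $[\mathfrak x_k,\mathfrak x_l]=0$ on $\mathbb C^n$ for all $k,l=1,\ldots,2m$. The $2n\times 2n$ matrices are given by columns: $A_j=\|a_{1j}\ldots a_{nj}\,\overline a_{1,m+j}\ldots\overline a_{n,m+j}\|$, $A_{m+j}=\|a_{1,m+j}\ldots a_{n,m+j}\,\overline a_{1j}\ldots\overline a_{nj}\|$, $j=1,\ldots,m$, where $a_{\tau k}$ is the column $(a_{\tau k1},\ldots,a_{\tau k,2n})$ and $\overline a_{\tau k}$ is the column $(\overline{a_{\tau k,n+1}},\ldots,\overline{a_{\tau k,2n}},\overline{a_{\tau k1}},\ldots,\overline{a_{\tau kn}})$. Complete solvability is equivalent to $A_kA_l=A_lA_k$ for all $k,l$. Put $\gamma=(w_1,\ldots,w_n,\overline w_1,\ldots,\overline w_n)$ and $\nu\gamma=\sum_{\varrho=1}^{2n}\nu_\varrho\gamma_\varrho$ for $\nu\in\mathbb C^{2n}$. The index $\zeta\in\{1,\ldots,m\}$ is fixed so that $A_\zeta$ has the smallest number of elementary divisors; $(1.1.\zeta)$ is the system $dw_\tau=X_{\tau\zeta}(w)dz_\zeta+X_{\tau,m+\zeta}(w)d\overline z_\zeta$, $\tau=1,\ldots,n$, and a first integral of it here means a nonconstant function annihilated by $\mathfrak x_\zeta$. If $\nu^{0l}$ is an eigenvector of $A_\zeta$ for the eigenvalue $\lambda_l^\zeta$ with elementary divisor of multiplicity $s_l$, a nonzero vector $\nu^{\eta l}\in\mathbb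 C^{2n}$ is a generalized eigenvector of order $\eta$ if $(A_\zeta-\lambda_l^\zeta E)\nu^{\eta l}=\eta\,\nu^{\eta-1,l}$, $\eta=1,\ldots,s_l-1$ ($E$ the identity matrix). A domain is an open arcwise connected set. An $\mathbb R$-differentiable function (continuously differentiable in the real and imaginary parts) $F\colon\Omega\to\mathbb C$ is an autonomous first integral of the full system if $\mathfrak x_kF=0$ on $\Omega$, $k=1,\ldots,2m$. ${\rm D}(F)$ is the set where $F$ is defined and $\mathbb R$-differentiable (complex powers being fixed smooth branches). The $\varepsilon_\xi$ are nonnegative integers; empty sums are zero. *)

(* Defs.v *)
From HB Require Import structures.
From mathcomp Require Import all_boot all_order all_algebra.
From mathcomp Require Import complex.
From mathcomp Require Import all_classical all_reals all_analysis.

Set Implicit Arguments.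
Unset Strict Implicit.
Unset Printing Implicit Defensive.

Import Order.TTheory GRing.Theory Num.Theory.
Import numFieldNormedType.Exports.

Local Open Scope classical_set_scope.
Local Open Scope ring_scope.
Local Open Scope complex_scope.

(* The topology of the modulus, which R[i] does not carry by default. *)
HB.instance Definition _ (R : realType) :=
  NormedModule.copy R[i] ((R[i] : numFieldType)^o).

Section ElementaryDivisors.
Variables (K : closedFieldType) (N : nat) (A : 'M[K]_N).

(* gcd of the minors of order k of XE - A.  Non-increasing choices of rows or
   columns only add zeros and copies up to sign, so they do not change it; for
   k = 0 it is a nonzero constant. *)
Definition determinantal_divisor (k : nat) : {poly K} :=
  \big[@gcdp K/0]_(f : {ffun 'I_k -> 'I_N})
    \big[@gcdp K/0]_(g : {ffun 'I_k -> 'I_N}) \det (mxsub f g (char_poly_mx A)).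

Definition invariant_polynomial (k : nat) : {poly K} :=
  determinantal_divisor k %/ determinantal_divisor k.-1.

Definition distinct_roots (p : {poly K}) : seq K :=
  undup (sval (closed_field_poly_normal p)).

(* The pair (x, s) stands for the elementary divisor (X - x)^s; repetitions in
   the list are meaningful. *)
Definition elementary_divisors : seq (K * nat) :=
  [seq (x, mup x (invariant_polynomial k)) |
     k <- iota 1 N, x <- distinct_roots (invariant_polynomial k)].

End ElementaryDivisors.

Section RealDifferentiability.
Variables (R : realType) (n : nat).
Notation C := R[i].
Notation Cn := 'cV[R[i]]_n.

Definition cexp (z : C) : C :=
  (expR (complex.Re z))%:C * (cos (complex.Im z) +i* sin (complex.Im z)).

Definition re_line (f : Cn -> C) (w v : Cn) (t : R) : R :=
  complex.Re (f (w + t%:C *: v)).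
Definition im_line (f : Cn -> C) (w v : Cn) (t : R) : R :=
  complex.Im (f (w + t%:C *: v)).

Definition rderivable (v : Cn) (f : Cn -> C) (w : Cn) : Prop :=
  derivable (re_line f w v) 0 1 /\ derivable (im_line f w v) 0 1.
Definition rderive (v : Cn) (f : Cn -> C) (w : Cn) : C :=
  derive1 (re_line f w v) 0 +i* derive1 (im_line f w v) 0.

(* With w_xi = x_xi + i y_xi, differentiating along these two directions gives
   the partial derivatives with respect to x_xi and y_xi. *)
Definition dir_x (xi : 'I_n) : Cn := delta_mx xi 0.
Definition dir_y (xi : 'I_n) : Cn := 'i%C *: delta_mx xi 0.

Definition wirtinger (xi : 'I_n) (f : Cn -> C) (w : Cn) : C :=
  (rderive (dir_x xi) f w - 'i%C * rderive (dir_y xi) f w) / 2%:R.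
Definition wirtinger_bar (xi : 'I_n) (f : Cn -> C) (w : Cn) : C :=
  (rderive (dir_x xi) f w + 'i%C * rderive (dir_y xi) f w) / 2%:R.

(* Meant for open Omega: f is continuously differentiable on Omega in the 2n
   real coordinates. *)
Definition Rdifferentiable_on (Omega : set Cn) (f : Cn -> C) : Prop :=
  forall (xi : 'I_n) (v : Cn), v = dir_x xi \/ v = dir_y xi ->
  forall w, Omega w -> rderivable v f w /\ {for w, continuous (rderive v f)}.

Definition twice_Rdifferentiable (f : Cn -> C) : Prop :=
  Rdifferentiable_on setT f /\
  forall xi, Rdifferentiable_on setT (rderive (dir_x xi) f) /\
             Rdifferentiable_on setT (rderive (dir_y xi) f).

Definition is_domain (Omega : set Cn) : Prop :=
  open Omega /\
  forall x y, Omega x -> Omega y ->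
    exists p : R -> Cn, [/\ {within `[0, 1], continuous p}, p 0 = x, p 1 = y
                          & forall t, 0 <= t <= 1 -> Omega (p t)].

(* P is a smooth single-valued branch on Omega of the multivalued function
   g^h: locally P = exp (h * L) for a smooth logarithm L of g. *)
Definition power_branch (Omega : set Cn) (g : Cn -> C) (h : C) (P : Cn -> C) :=
  forall w0, Omega w0 ->
    exists (U : set Cn) (L : Cn -> C),
      [/\ open U, U w0, U `<=` Omega, Rdifferentiable_on U L
        & forall w, U w -> cexp (L w) = g w /\ P w = cexp (h * L w)].

End RealDifferentiability.

Section System.
Variables (R : realType) (m n : nat).
Notation C := R[i].
Notation Cn := 'cV[R[i]]_n.

(* The coefficient a tau k is the column (a_{tau k 1}, ..., a_{tau k 2n}). *)
Variable a : 'I_n -> 'I_(m + m) -> 'cV[R[i]]_(n + n).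

Definition conj_mx p q (M : 'M[C]_(p, q)) : 'M[C]_(p, q) :=
  map_mx (@conjc R) M.

Definition gamma_vec (w : Cn) : 'cV[C]_(n + n) := col_mx w (conj_mx w).

Definition lin_form (nu : 'cV[C]_(n + n)) (w : Cn) : C :=
  \sum_(rho < n + n) nu rho 0 * gamma_vec w rho 0.

Definition sysX (tau : 'I_n) (k : 'I_(m + m)) (w : Cn) : C :=
  \sum_(xi < n) (a tau k (lshift n xi) 0 * w xi 0
                 + a tau k (rshift n xi) 0 * (w xi 0)^*%C).

(* Exchanges j and m + j. *)
Definition swap_index (k : 'I_(m + m)) : 'I_(m + m) :=
  match fintype.split k with inl j => rshift m j | inr j => lshift m j end.

(* The operators x_k; swap_index merges the cases k = j and k = m + j. *)
Definition opX (k : 'I_(m + m)) (f : Cn -> C) (w : Cn) : C :=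
  \sum_(xi < n) (sysX xi k w * wirtinger xi f w
                 + (sysX xi (swap_index k) w)^*%C * wirtinger_bar xi f w).

Definition completely_solvable : Prop :=
  forall k l (f : Cn -> C), twice_Rdifferentiable f ->
    forall w, opX k (opX l f) w - opX l (opX k f) w = 0.

Definition bar_coef (tau : 'I_n) (k : 'I_(m + m)) : 'cV[C]_(n + n) :=
  col_mx (conj_mx (dsubmx (a tau k))) (conj_mx (usubmx (a tau k))).

Definition matA (k : 'I_(m + m)) : 'M[C]_(n + n) :=
  row_mx (\matrix_(rho, tau) a tau k rho 0)
         (\matrix_(rho, tau) bar_coef tau (swap_index k) rho 0).

Definition autonomous_first_integral (Omega : set Cn) (F : Cn -> C) : Prop :=
  Rdifferentiable_on Omega F /\ forall k w, Omega w -> opX k F w = 0.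

Definition ode_first_integral (zeta : 'I_m) (Omega : set Cn) (f : Cn -> C) :=
  [/\ Rdifferentiable_on Omega f,
      exists w1 w2, [/\ Omega w1, Omega w2 & f w1 <> f w2]
    & forall w, Omega w -> opX (lshift m zeta) f w = 0].

End System.

(* Main.v *)
Require Import Defs.
From HB Require Import structures.
From mathcomp Require Import all_boot all_order all_algebra.
From mathcomp Require Import complex.
From mathcomp Require Import all_classical all_reals all_analysis.
From mathcomp Require Import ring lra.

(** The operators X_k are derivations, and X_k maps the linear form of nu to the
    linear form of A_k nu (opX_lin_form).  A common eigenvector therefore gives a
    form that is an eigenfunction of every X_k, with eigenvalue lambda_k, and a
    power of it with exponent h is an eigenfunction with eigenvalue h lambda_k
    (opX_power_branch).

    Along a Jordan chain of A_zeta, the functions Psi are the coefficients of the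
    logarithm of the exponential generating series of the linear forms.  On that
    series X_zeta acts as multiplication by lambda + t, so X_zeta Psi_1 = 1 and
    X_zeta Psi_eta = 0 for eta > 1 (opX_chain_quotient).

    For the other operators, complete solvability gives
    X_zeta X_k Psi = X_k X_zeta Psi = 0.  It is an identity for functions on the
    whole space, whereas Psi is a quotient defined on Omega; but the commutator
    of two derivations is a derivation, and vanishing on linear forms it vanishes
    on everything rational in them (rational_opX_comm).  So X_k Psi is annihilated
    by X_zeta, and since it is not a first integral it is a constant mu
    (opX_const_of_not_first_integral).

    Hence exp (sum of h_q Psi_q) is an eigenfunction with eigenvalue the sum of
    the mu_q h_q, and the product F is an eigenfunction of X_k whose eigenvalue
    is the left-hand side of the k-th linear equation for h.  These are 2m
    equations in 2m + 1 unknowns.  Finally F is continuously differentiable,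
    because functions with continuous partial derivatives are continuous
    (C1_continuous) and so form an algebra stable under inverses and
    exponentials. *)

Set Implicit Arguments.
Unset Strict Implicit.
Unset Printing Implicit Defensive.

Import Order.TTheory GRing.Theory Num.Theory.
Import numFieldNormedType.Exports.

Local Open Scope classical_set_scope.
Local Open Scope ring_scope.
Local Open Scope complex_scope.

(** * Real and imaginary parts in the topology of the complex plane *)

Section ComplexTopology.
Variable R : realType.
Notation C := R[i].

Lemma ReD (x y : C) : complex.Re (x + y) = complex.Re x + complex.Re y.
Proof. by case: x; case: y. Qed.
Lemma ImD (x y : C) : complex.Im (x + y) = complex.Im x + complex.Im y.
Proof. by case: x; case: y. Qed.
Lemma ReN (x : C) : complex.Re (- x) = - complex.Re x.
Proof. by case: x. Qed.
Lemma ImN (x : C) : complex.Im (- x) = - complex.Im x.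
Proof. by case: x. Qed.
Lemma ReB (x y : C) : complex.Re (x - y) = complex.Re x - complex.Re y.
Proof. by rewrite ReD ReN. Qed.
Lemma ImB (x y : C) : complex.Im (x - y) = complex.Im x - complex.Im y.
Proof. by rewrite ImD ImN. Qed.
Lemma ReM (x y : C) : complex.Re (x * y) =
  complex.Re x * complex.Re y - complex.Im x * complex.Im y.
Proof. by case: x; case: y. Qed.
Lemma ImM (x y : C) : complex.Im (x * y) =
  complex.Re x * complex.Im y + complex.Im x * complex.Re y.
Proof. by case: x; case: y. Qed.

(** Complex numbers are comparable only when their imaginary parts agree, so the
    radii of balls over the complex field are real. *)
Lemma gt0_complexE (e : C) : 0 < e -> e = (complex.Re e)%:C /\ 0 < complex.Re e.
Proof. by case: e => x y; rewrite ltcE /= => /andP[/eqP -> ->]. Qed.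

Lemma normc_ltE (z : C) (e : R) :
  (`|z| < e%:C) = (Num.sqrt (complex.Re z ^+ 2 + complex.Im z ^+ 2) < e).
Proof. by rewrite normc_def ltcE /= eqxx. Qed.

Lemma normc_lt_ReIm (z : C) (e : R) :
  `|z| < e%:C -> `|complex.Re z| < e /\ `|complex.Im z| < e.
Proof.
rewrite normc_ltE => h; split; apply: le_lt_trans h.
  by rewrite -sqrtr_sqr ler_sqrt ?lerDl ?addr_ge0 ?sqr_ge0.
by rewrite -sqrtr_sqr ler_sqrt ?lerDr ?addr_ge0 ?sqr_ge0.
Qed.

Lemma ReIm_lt_normc (z : C) (e : R) : 0 < e ->
  `|complex.Re z| < e / 2 -> `|complex.Im z| < e / 2 -> `|z| < e%:C.
Proof.
move=> e0 h1 h2; rewrite normc_ltE.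
rewrite -[ltRHS](ger0_norm (ltW e0)) -sqrtr_sqr ltr_sqrt ?exprn_gt0 //.
have e20 : 0 <= e / 2 by rewrite divr_ge0 ?ltW.
have s1 : complex.Re z ^+ 2 < (e / 2) ^+ 2.
  by rewrite -[X in X < _]real_normK ?num_real // ltr_pXn2r ?nnegrE.
have s2 : complex.Im z ^+ 2 < (e / 2) ^+ 2.
  by rewrite -[X in X < _]real_normK ?num_real // ltr_pXn2r ?nnegrE.
apply: lt_le_trans (ltrD s1 s2) _.
rewrite expr_div_n (_ : e ^+ 2 / 2 ^+ 2 + _ = e ^+ 2 / 2); last by field.
by rewrite ler_pdivrMr // ler_peMr ?sqr_ge0 // ler1n.
Qed.

Lemma cvg_ReIm (T : Type) (F : set_system T) (FF : Filter F) (f : T -> C) (l : C) :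
  f @ F --> l <->
  (@complex.Re R \o f @ F --> complex.Re l) /\ (@complex.Im R \o f @ F --> complex.Im l).
Proof.
split=> [h|[h1 h2]].
  have hd (e : R) : 0 < e -> \forall x \near F, `|l - f x| < e%:C.
    by move=> e0; move/cvgrPdist_lt : h; apply; rewrite ltcR.
  split; apply/cvgrPdist_lt => e /hd; apply: filterS => x /normc_lt_ReIm [] h1 h2.
    by have := ReB l (f x); rewrite /= => <-.
  by have := ImB l (f x); rewrite /= => <-.
apply/cvgrPdist_lt => e e0.
have [eE er0] := gt0_complexE e0.
have e20 : 0 < complex.Re e / 2 by rewrite divr_gt0.
move/cvgrPdist_lt : h1 => /(_ _ e20) h1.
move/cvgrPdist_lt : h2 => /(_ _ e20) h2.
near=> x; rewrite eE; apply: ReIm_lt_normc => //; rewrite ?ReB ?ImB /=.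
- by near: x.
- by near: x.
Unshelve. all: by end_near. Qed.

Lemma continuous_ReIm (T : topologicalType) (f : T -> C) (x : T) :
  {for x, continuous f} <->
  {for x, continuous (@complex.Re R \o f)} /\ {for x, continuous (@complex.Im R \o f)}.
Proof. exact: cvg_ReIm. Qed.

(** Real boxes are stable under changing one real coordinate at a time, which is
    what the mean value argument for C1 functions moves along. *)
Definition box n (w0 : 'cV[C]_n) (e : R) : set 'cV[C]_n :=
  [set w | forall i, `|complex.Re (w i 0 - w0 i 0)| < e /\
                     `|complex.Im (w i 0 - w0 i 0)| < e].

Lemma nbhs_box n (w0 : 'cV[C]_n) (U : set 'cV[C]_n) :
  nbhs w0 U <-> exists2 e : R, 0 < e & box w0 e `<=` U.
Proof.
split=> [|[e e0 eU]].
  rewrite -nbhs_ballE => -[e /= e0 eU].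
  have [eE er0] := gt0_complexE e0.
  exists (complex.Re e / 2); first by rewrite divr_gt0.
  move=> w hw; apply: eU; split => // i j.
  rewrite (ord1 j) /ball /= eE -normrN opprB; have [h1 h2] := hw i.
  exact: ReIm_lt_normc.
rewrite -nbhs_ballE; exists e%:C; first by rewrite /= ltcR.
move=> w [_ hw]; apply: eU => i; apply: normc_lt_ReIm.
by have := hw i 0; rewrite /ball /= -normrN opprB.
Qed.

Lemma ler_term_sum n (F : 'I_n -> R) (i : 'I_n) :
  (forall j, 0 <= F j) -> F i <= \sum_j F j.
Proof. by move=> F0; rewrite (bigD1 i) //= lerDl; apply: sumr_ge0. Qed.

End ComplexTopology.

(** * Continuously differentiable functions are continuous *)

Section C1Continuous.
Variables (R : realType) (n : nat).
Notation C := R[i].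
Notation Cn := 'cV[R[i]]_n.

Definition line_derive (g : Cn -> R) (w v : Cn) (d : R) :=
  is_derive (0 : R) (1 : R) (fun t : R => g (w + t%:C *: v)) d.

Lemma line_derive_at (g : Cn -> R) (w v : Cn) (t0 d : R) :
  line_derive g (w + t0%:C *: v) v d ->
  is_derive t0 (1 : R) (fun t : R => g (w + t%:C *: v)) d.
Proof.
rewrite /line_derive => h.
have -> : (fun t : R => g (w + t%:C *: v)) =
   (fun s : R => g (w + t0%:C *: v + s%:C *: v)) \o (fun t => t - t0).
  apply/funext => t /=; congr g.
  by rewrite -addrA -scalerDl -rmorphD /= [t0 + _]addrC subrK.
rewrite -[d]mulr1; apply: is_derive1_comp; rewrite ?subrr //.
apply: is_derive_eq; by rewrite ?subr0 ?oppr0 ?addr0.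
Qed.

Lemma line_increment_segment (g : Cn -> R) (w v : Cn) (a b M : R) : a <= b ->
  (forall t, a <= t <= b ->
     exists2 d, line_derive g (w + t%:C *: v) v d & `|d| <= M) ->
  `|g (w + b%:C *: v) - g (w + a%:C *: v)| <= M * (b - a).
Proof.
move=> ab h.
have /choice[D hD] : forall t, exists d, a <= t <= b ->
    line_derive g (w + t%:C *: v) v d /\ `|d| <= M.
  move=> t; have [/h[d d1 d2]|_] := boolP (a <= t <= b); last by exists 0.
  by exists d.
have der t : a <= t <= b -> is_derive t (1 : R) (fun t : R => g (w + t%:C *: v)) (D t).
  by move=> /hD[/line_derive_at].
have [|/=|c + ->] := @MVT_segment R (fun t : R => g (w + t%:C *: v)) D a b ab.
- move=> t; rewrite in_itv /= => /andP[t1 t2]; apply: der.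
  by rewrite !ltW.
- apply: derivable_within_continuous => t; rewrite in_itv /= => tab.
  by case: (der t tab).
rewrite in_itv /= => /hD[_ hM].
by rewrite normrM (ger0_norm (x := b - a)) ?subr_ge0 // ler_wpM2r ?subr_ge0.
Qed.

Lemma line_increment (g : Cn -> R) (w v : Cn) (tau M : R) :
  (forall t : R, `|t| <= `|tau| ->
     exists2 d, line_derive g (w + t%:C *: v) v d & `|d| <= M) ->
  `|g (w + tau%:C *: v) - g w| <= M * `|tau|.
Proof.
move=> h.
have w0 : w = w + (0 : R)%:C *: v by rewrite rmorph0 scale0r addr0.
have [t0|/ltW t0] := leP 0 tau.
  rewrite {2}w0 -[X in _ * `|X|](subr0 tau) (ger0_norm (x := tau - 0)) ?subr0 //.
  rewrite -[X in _ * X](subr0 tau).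
  apply: line_increment_segment => // t /andP[t1 t2].
  by apply: h; rewrite !ger0_norm.
rewrite distrC {1}w0 (ler0_norm t0) -[- tau]add0r.
apply: line_increment_segment => // t /andP[t1 t2].
by apply: h; rewrite !ler0_norm // lerN2.
Qed.

(** Near w0 all the partial derivatives are bounded by a common M.  A point w of
    a small box around w0 is reached by replacing the coordinates of w0 one after
    the other, first the real and then the imaginary part; the whole path stays
    in the box, so by the mean value theorem each of the 2n moves changes g by at
    most M times its length. *)
Lemma C1_continuous (Omega : set Cn) (g : Cn -> R) (D : Cn -> Cn -> R) (w0 : Cn) :
  nbhs w0 Omega ->
  (forall (xi : 'I_n) (v : Cn), v = dir_x R xi \/ v = dir_y R xi ->
     (forall w, Omega w -> line_derive g w v (D v w)) /\
     {for w0, continuous (D v)}) ->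
  {for w0, continuous g}.
Proof.
move=> Om hD.
pose M : R := 1 + \sum_(xi < n) (`|D (dir_x R xi) w0| + `|D (dir_y R xi) w0|).
have M0 : 0 < M.
  by rewrite /M ltr_pwDl //; apply: sumr_ge0 => xi _; apply: addr_ge0.
have hM xi : `|D (dir_x R xi) w0| + 1 <= M /\ `|D (dir_y R xi) w0| + 1 <= M.
  have : `|D (dir_x R xi) w0| + `|D (dir_y R xi) w0| <= M - 1.
    rewrite /M [1 + _]addrC addrK.
    apply: (ler_term_sum (F := fun i => `|D (dir_x R i) w0| + `|D (dir_y R i) w0|)).
    by move=> i; apply: addr_ge0.
  have := normr_ge0 (D (dir_x R xi) w0); have := normr_ge0 (D (dir_y R xi) w0).
  by move=> *; split; lra.
have bounded_near v (c : R) : {for w0, continuous (D v)} -> `|D v w0| + 1 <= c ->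
    \forall w \near w0, `|D v w| <= c.
  move=> /cvgrPdist_lt/(_ 1 ltr01) + hc; apply: filterS => w hw.
  rewrite -(subrK (D v w0) (D v w)) (le_trans (ler_normD _ _)) //.
  by rewrite distrC in hw; lra.
have near_all : \forall w \near w0, Omega w /\ forall xi : 'I_n,
    `|D (dir_x R xi) w| <= M /\ `|D (dir_y R xi) w| <= M.
  apply: filterI => //.
  apply: (@filter_forall _ _ (fun (xi : 'I_n) w =>
    `|D (dir_x R xi) w| <= M /\ `|D (dir_y R xi) w| <= M)
    (nbhs w0) (nbhs_filter w0)) => xi.
  have [h1 h2] := hM xi.
  apply: filterI.
    by apply: bounded_near h1; apply: (hD xi _ _).2; left.
  by apply: bounded_near h2; apply: (hD xi _ _).2; right.
have [e0 e0_gt0 hbox] := (nbhs_box _ _).1 near_all.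
apply/(@cvgrPdist_lt _ _ _ _ (nbhs_filter w0)) => eps eps0.
pose c : R := n%:R * (M + M) + 1.
have c0 : 0 < c by rewrite ltr_pwDr // mulr_ge0 // addr_ge0 // ltW.
pose e := Num.min e0 (eps / c).
have e_gt0 : 0 < e by rewrite lt_min e0_gt0 divr_gt0.
apply/nbhs_box; exists e => // w hw.
pose p k : Cn := \col_i (if (i < k)%N then w i 0 else w0 i 0).
have step (k : 'I_n) : `|g (p k.+1) - g (p k)| <= (M + M) * e.
  pose x := complex.Re (w k 0 - w0 k 0); pose y := complex.Im (w k 0 - w0 k 0).
  have [hx hy] : `|x| < e /\ `|y| < e by exact: hw.
  pose q (s t : R) := p k + s%:C *: dir_x R k + t%:C *: dir_y R k.
  have q_in (s t : R) : `|s| <= `|x| -> `|t| <= `|y| -> box w0 e0 (q s t).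
    move=> hs ht i.
    have ee0 : e <= e0 by rewrite ge_min lexx.
    have [->|ik] := eqVneq i k.
      have -> : q s t k 0 - w0 k 0 = s%:C + 'i%C * t%:C.
        by rewrite /q /p !mxE eqxx ltnn /=; ring.
      have -> : complex.Re (s%:C + 'i%C * t%:C) = s by rewrite ReD ReM /=; ring.
      have -> : complex.Im (s%:C + 'i%C * t%:C) = t by rewrite ImD ImM /=; ring.
      by split; [apply: le_lt_trans hs _|apply: le_lt_trans ht _]; lra.
    rewrite /q /p !mxE (negbTE ik) /= !mulr0 !addr0; case: ifP => _.
      by have [] := hw i; split; lra.
    by rewrite subrr /= normr0.
  have p1 : p k.+1 = q x y.
    apply/matrixP => i j; rewrite (ord1 j) /q /p !mxE eqxx andbT ltnS leq_eqVlt.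
    have [->|ik] := eqVneq i k.
      rewrite eqxx ltnn /= !mulr1 -addrA mulrC.
      have -> : x%:C + 'i%C * y%:C = w k 0 - w0 k 0.
        by rewrite [RHS]complexE.
      by rewrite addrC subrK.
    by rewrite -val_eqE /= in ik; rewrite (negbTE ik) /= !mulr0 !addr0.
  have q0 : p k = q 0 0 by rewrite /q !rmorph0 !scale0r !addr0.
  have qx (t : R) : q t 0 = p k + t%:C *: dir_x R k.
    by rewrite /q (_ : (0 : R)%:C = 0) // scale0r addr0.
  have n1 : `|g (q x 0) - g (p k)| <= M * `|x|.
    rewrite qx; apply: line_increment => t tx; rewrite -qx.
    have [Oq hq] : (Omega `&` [set w | forall xi : 'I_n,
        `|D (dir_x R xi) w| <= M /\ `|D (dir_y R xi) w| <= M]) (q t 0).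
      by apply: hbox; apply: q_in; rewrite ?normr0.
    exists (D (dir_x R k) (q t 0)); last exact: (hq k).1.
    by apply: (hD k _ _).1 => //; left.
  have n2 : `|g (q x y) - g (q x 0)| <= M * `|y|.
    rewrite {1}/q -qx; apply: line_increment => t tx; rewrite qx -/(q x t).
    have [Oq hq] : (Omega `&` [set w | forall xi : 'I_n,
        `|D (dir_x R xi) w| <= M /\ `|D (dir_y R xi) w| <= M]) (q x t).
      by apply: hbox; apply: q_in.
    exists (D (dir_y R k) (q x t)); last exact: (hq k).2.
    by apply: (hD k _ _).1 => //; right.
  rewrite p1 -(subrK (g (q x 0)) (g (q x y))) -addrA.
  apply: le_trans (ler_normD _ _) _; rewrite mulrDl; apply: lerD.
    by apply: le_trans n2 _; rewrite ler_pM2l // ltW.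
  by apply: le_trans n1 _; rewrite ler_pM2l // ltW.
have pn : p n = w by apply/matrixP => i j; rewrite (ord1 j) mxE ltn_ord.
have p0 : p 0%N = w0 by apply/matrixP => i j; rewrite (ord1 j) mxE.
have tele k : (k <= n)%N -> `|g (p k) - g w0| <= k%:R * ((M + M) * e).
  elim: k => [|k IH] kn; first by rewrite p0 subrr normr0 mul0r.
  rewrite -(subrK (g (p k)) (g (p k.+1))) -addrA -natr1 mulrDl mul1r addrC.
  apply: le_trans (ler_normD _ _) _; apply: lerD; first exact/IH/ltnW.
  exact: (step (Ordinal kn)).
rewrite /= distrC -pn; apply: le_lt_trans (tele n (leqnn n)) _.
rewrite mulrA; apply: le_lt_trans (ler_wpM2l _ (_ : e <= eps / c)) _.
- by rewrite mulr_ge0 // addr_ge0 // ltW.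
- by rewrite ge_min lexx orbT.
rewrite mulrA ltr_pdivrMr // mulrC ltr_pM2l // /c; lra.
Qed.

End C1Continuous.

(** * Calculus of real directional derivatives *)

Section RealCalculus.
Variables (R : realType) (n : nat).
Notation C := R[i].
Notation Cn := 'cV[R[i]]_n.
Implicit Types (f g : Cn -> C) (v w : Cn) (Omega : set Cn).

(** Existence and value of the derivative in one relation, so that derivatives of
    compound functions are computed by composing proofs. *)
Definition is_rderive v f w (d : C) : Prop :=
  is_derive (0 : R) (1 : R) (re_line f w v) (complex.Re d) /\
  is_derive (0 : R) (1 : R) (im_line f w v) (complex.Im d).

Lemma rderivableP v f w : rderivable v f w -> is_rderive v f w (rderive v f w).
Proof.
by move=> [h1 h2]; split; rewrite /rderive /= derive1E; split.
Qed.

Lemma is_rderiveE v f w d : is_rderive v f w d -> rderive v f w = d.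
Proof.
move=> [[_ h1] [_ h2]]; rewrite /rderive !derive1E h1 h2.
by case: d {h1 h2}.
Qed.

Lemma is_rderive_rderivable v f w d : is_rderive v f w d -> rderivable v f w.
Proof. by move=> [[h1 _] [h2 _]]. Qed.

Lemma near_line v w (U : set Cn) : nbhs w U ->
  \forall t \near (0 : R), U (w + t%:C *: v).
Proof.
move=> /nbhs_box [e e0 eU].
pose K : R := 1 + \sum_(i < n) (`|complex.Re (v i 0)| + `|complex.Im (v i 0)|).
have K0 : 0 < K.
  by rewrite /K ltr_pwDl //; apply: sumr_ge0 => i _; apply: addr_ge0.
have hK i : `|complex.Re (v i 0)| < K /\ `|complex.Im (v i 0)| < K.
  have : `|complex.Re (v i 0)| + `|complex.Im (v i 0)| <= K - 1.
    rewrite /K [1 + _]addrC addrK.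
    apply: (ler_term_sum (F := fun j => `|complex.Re (v j 0)| + `|complex.Im (v j 0)|)).
    by move=> j; apply: addr_ge0.
  have := normr_ge0 (complex.Re (v i 0)); have := normr_ge0 (complex.Im (v i 0)).
  by move=> *; split; lra.
have eK0 : 0 < e / K by rewrite divr_gt0.
have := @nbhs0_lt R R _ eK0; apply: filterS => t.
rewrite ltr_pdivlMr // => ht; apply: eU => i.
have -> : (w + t%:C *: v) i 0 - w i 0 = t%:C * v i 0 by rewrite !mxE addrC addKr.
have [h1 h2] := hK i.
rewrite ReM ImM /= !mul0r subr0 addr0 !normrM.
split; apply: le_lt_trans ht; apply: ler_wpM2l => //; exact: ltW.
Qed.

Lemma is_rderive_near v f g w d :
  (\forall x \near w, f x = g x) -> is_rderive v f w d -> is_rderive v g w d.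
Proof.
move=> /(near_line v) fg [h1 h2]; split.
  apply: near_eq_is_derive h1; move: fg; apply: filterS => t.
  by rewrite /re_line => ->.
apply: near_eq_is_derive h2; move: fg; apply: filterS => t.
by rewrite /im_line => ->.
Qed.

Lemma is_rderive_cst v c w : is_rderive v (fun=> c) w 0.
Proof. by split; apply: is_derive_cst. Qed.

Lemma is_rderiveD v f g w df dg :
  is_rderive v f w df -> is_rderive v g w dg ->
  is_rderive v (fun x => f x + g x) w (df + dg).
Proof.
move=> [f1 f2] [g1 g2]; split.
  rewrite ReD (_ : re_line _ _ _ = re_line f w v + re_line g w v).
    exact: is_deriveD.
  by apply/funext => t; rewrite /re_line ReD.
rewrite ImD (_ : im_line _ _ _ = im_line f w v + im_line g w v).
  exact: is_deriveD.
by apply/funext => t; rewrite /im_line ImD.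
Qed.

Lemma re_line0 f w v : re_line f w v 0 = complex.Re (f w).
Proof. by rewrite /re_line rmorph0 scale0r addr0. Qed.
Lemma im_line0 f w v : im_line f w v 0 = complex.Im (f w).
Proof. by rewrite /im_line rmorph0 scale0r addr0. Qed.

Lemma is_rderiveM v f g w df dg :
  is_rderive v f w df -> is_rderive v g w dg ->
  is_rderive v (fun x => f x * g x) w (f w * dg + g w * df).
Proof.
move=> [f1 f2] [g1 g2]; split.
  rewrite (_ : re_line _ _ _ = re_line f w v * re_line g w v
                             - im_line f w v * im_line g w v); last first.
    by apply/funext => t; rewrite /re_line ReM.
  apply: is_derive_eq.
  by rewrite !re_line0 !im_line0 ReD !ReM /GRing.scale /=; ring.
rewrite (_ : im_line _ _ _ = re_line f w v * im_line g w v
                             + im_line f w v * re_line g w v); last first.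
  by apply/funext => t; rewrite /im_line ImM.
apply: is_derive_eq.
by rewrite !re_line0 !im_line0 ImD !ImM /GRing.scale /=; ring.
Qed.

Lemma is_rderive_exp v f w df :
  is_rderive v f w df ->
  is_rderive v (fun x => cexp (f x)) w (cexp (f w) * df).
Proof.
move=> [f1 f2].
have e1 : is_derive (0 : R) (1 : R) (expR \o re_line f w v)
    (expR (complex.Re (f w)) * complex.Re df).
  by apply: is_derive1_comp; rewrite re_line0; exact: is_derive_expR.
have c1 : is_derive (0 : R) (1 : R) (cos \o im_line f w v)
    (- sin (complex.Im (f w)) * complex.Im df).
  by apply: is_derive1_comp; rewrite im_line0; exact: is_derive_cos.
have s1 : is_derive (0 : R) (1 : R) (sin \o im_line f w v)
    (cos (complex.Im (f w)) * complex.Im df).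
  by apply: is_derive1_comp; rewrite im_line0; exact: is_derive_sin.
split.
  rewrite (_ : re_line _ _ _ = (expR \o re_line f w v) * (cos \o im_line f w v));
    last by apply/funext => t; rewrite /re_line /cexp ReM /= mul0r subr0.
  apply: is_derive_eq.
  by rewrite /= !re_line0 !im_line0 ReM /cexp ReM ImM /GRing.scale /=; ring.
rewrite (_ : im_line _ _ _ = (expR \o re_line f w v) * (sin \o im_line f w v));
  last by apply/funext => t; rewrite /im_line /cexp ImM /= mul0r addr0.
apply: is_derive_eq.
by rewrite /= !re_line0 !im_line0 ImM /cexp ReM ImM /GRing.scale /=; ring.
Qed.

Lemma normc2_gt0 (z : C) : z != 0 -> 0 < complex.Re z ^+ 2 + complex.Im z ^+ 2.
Proof.
case: z => x y; rewrite eq_complex /= => h.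
have x2 := sqr_ge0 x; have y2 := sqr_ge0 y.
rewrite lt_neqAle addr_ge0 // andbT eq_sym paddr_eq0 //.
by rewrite !sqrf_eq0.
Qed.

Lemma is_rderiveV v f w df : f w != 0 ->
  is_rderive v f w df ->
  is_rderive v (fun x => (f x)^-1) w (- (f w) ^- 2 * df).
Proof.
move=> f0 [f1 f2].
have fn0 := lt0r_neq0 (normc2_gt0 f0).
(* Re (1 / f) = Re f / N and Im (1 / f) = - Im f / N along the line *)
pose N : R -> R := re_line f w v ^+ 2 + im_line f w v ^+ 2.
have N1 : is_derive (0 : R) (1 : R) N
   (2 * (complex.Re (f w) * complex.Re df + complex.Im (f w) * complex.Im df)).
  apply: is_derive_eq.
  by rewrite /= !re_line0 !im_line0 /GRing.scale /= ?expr1 ?mulr_natl ?mulr2n; ring.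
have N0 : N 0 = complex.Re (f w) ^+ 2 + complex.Im (f w) ^+ 2.
  by rewrite -(re_line0 f w v) -(im_line0 f w v).
have N0' : N 0 != 0 by rewrite N0.
have V1 := @is_deriveV R N 0 _ 1 N0' N1.
have inv2 (z : C) : z != 0 -> z^-1 ^+ 2 =
   ((complex.Re z ^+ 2 - complex.Im z ^+ 2) /
      (complex.Re z ^+ 2 + complex.Im z ^+ 2) ^+ 2)
   +i* (- (2 * complex.Re z * complex.Im z) /
      (complex.Re z ^+ 2 + complex.Im z ^+ 2) ^+ 2).
  move=> z0; have zn0 := lt0r_neq0 (normc2_gt0 z0).
  rewrite expr2; apply/eqP; rewrite eq_complex ReM ImM.
  case: z z0 zn0 => x y /= _ h.
  by apply/andP; split; apply/eqP; field.
have ReV (z : C) : complex.Re z^-1 =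
   complex.Re z / (complex.Re z ^+ 2 + complex.Im z ^+ 2) by case: z.
have ImV (z : C) : complex.Im z^-1 =
   - complex.Im z / (complex.Re z ^+ 2 + complex.Im z ^+ 2).
  by case: z => x y /=; rewrite mulNr.
split.
  rewrite (_ : re_line _ _ _ = re_line f w v * (fun t => (N t)^-1));
    last by apply/funext => t; rewrite /re_line ReV.
  apply: is_derive_eq; rewrite /= re_line0 N0 -(exprVn (f w)) ReM ReN ImN inv2 //=.
  by rewrite /GRing.scale /=; field.
rewrite (_ : im_line _ _ _ = - im_line f w v * (fun t => (N t)^-1));
    last by apply/funext => t; rewrite /im_line ImV.
apply: is_derive_eq; rewrite /= N0 -(exprVn (f w)) ImM ReN ImN inv2 //=.
rewrite -[(- im_line f w v) 0]/(- (im_line f w v 0)) im_line0.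
by rewrite /GRing.scale /=; field.
Qed.

End RealCalculus.

(** * Closure of the differentiable functions, and the operators as derivations *)

Section Rdifferentiable.
Variables (R : realType) (n : nat).
Notation C := R[i].
Notation Cn := 'cV[R[i]]_n.
Implicit Types (f g : Cn -> C) (v w : Cn).

Lemma continuous_near f g w :
  (\forall x \near w, f x = g x) -> {for w, continuous f} -> {for w, continuous g}.
Proof.
move=> fg; rewrite /prop_for /continuous_at -(nbhs_singleton fg) => cf.
apply: cvg_trans cf; apply: (@near_eq_cvg _ _ (nbhs w) (nbhs_filter w)).
by move: fg; apply: filterS => x.
Qed.

Lemma continuousC_D f g w : {for w, continuous f} -> {for w, continuous g} ->
  {for w, continuous (fun w => f w + g w)}.
Proof.
move=> /continuous_ReIm [f1 f2] /continuous_ReIm [g1 g2].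
apply/continuous_ReIm; split.
  rewrite (_ : _ \o _ = (@complex.Re R \o f) + (@complex.Re R \o g)).
    exact: continuousD.
  by apply/funext => x /=; rewrite ReD.
rewrite (_ : _ \o _ = (@complex.Im R \o f) + (@complex.Im R \o g)).
  exact: continuousD.
by apply/funext => x /=; rewrite ImD.
Qed.

Lemma continuousC_M f g w : {for w, continuous f} -> {for w, continuous g} ->
  {for w, continuous (fun w => f w * g w)}.
Proof.
move=> /continuous_ReIm [f1 f2] /continuous_ReIm [g1 g2].
apply/continuous_ReIm; split.
  rewrite (_ : _ \o _ = (@complex.Re R \o f) * (@complex.Re R \o g)
                       - (@complex.Im R \o f) * (@complex.Im R \o g)).
    by apply: continuousB; exact: continuousM.
  by apply/funext => x /=; rewrite ReM.
rewrite (_ : _ \o _ = (@complex.Re R \o f) * (@complex.Im R \o g)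
                     + (@complex.Im R \o f) * (@complex.Re R \o g)).
  by apply: continuousD; exact: continuousM.
by apply/funext => x /=; rewrite ImM.
Qed.

Lemma continuousC_V f w : f w != 0 -> {for w, continuous f} ->
  {for w, continuous (fun w => (f w)^-1)}.
Proof.
by move=> f0 hf; exact: (@cvgV (R[i] : numFieldType) _ (nbhs w) (nbhs_filter w)).
Qed.

Lemma continuousC_cst (c : C) w : {for w, continuous (fun _ : Cn => c)}.
Proof. exact: (@cvg_cst _ c _ _ (nbhs_filter w)). Qed.

Lemma continuousC_exp f w : {for w, continuous f} ->
  {for w, continuous (fun w => cexp (f w))}.
Proof.
move=> /continuous_ReIm [h1 h2]; apply/continuous_ReIm; split.
  rewrite (_ : _ \o _ = (expR \o (@complex.Re R \o f)) * (cos \o (@complex.Im R \o f))).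
    apply: continuousM; apply: continuous_comp => //.
      exact: continuous_expR.
    exact: continuous_cos.
  by apply/funext => x; rewrite /cexp /= mul0r subr0.
rewrite (_ : _ \o _ = (expR \o (@complex.Re R \o f)) * (sin \o (@complex.Im R \o f))).
  apply: continuousM; apply: continuous_comp => //.
    exact: continuous_expR.
  exact: continuous_sin.
by apply/funext => x; rewrite /cexp /= mul0r addr0.
Qed.

Section OnOpen.
Variables (Omega : set Cn) (oOmega : open Omega).

Lemma near_open w (P : Cn -> Prop) :
  Omega w -> (forall x, Omega x -> P x) -> \forall x \near w, P x.
Proof. by move=> Ow hP; apply: filterS (open_nbhs_nbhs (conj oOmega Ow)). Qed.

Lemma Rdifferentiable_intro f (D : Cn -> Cn -> C) :
  (forall (xi : 'I_n) v, v = dir_x R xi \/ v = dir_y R xi ->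
    forall w, Omega w -> is_rderive v f w (D v w) /\ {for w, continuous (D v)}) ->
  Rdifferentiable_on Omega f.
Proof.
move=> h xi v hv w Ow; split; first exact: is_rderive_rderivable (h xi v hv w Ow).1.
apply: continuous_near (h xi v hv w Ow).2.
apply: near_open => // x Ox; apply/esym/is_rderiveE.
exact: (h xi v hv x Ox).1.
Qed.

Lemma Rdifferentiable_derive f (xi : 'I_n) v w :
  Rdifferentiable_on Omega f -> v = dir_x R xi \/ v = dir_y R xi ->
  Omega w -> is_rderive v f w (rderive v f w).
Proof. by move=> hf hv Ow; apply: rderivableP; exact: (hf xi v hv w Ow).1. Qed.

(** The definition asks continuity of the partial derivatives only; continuity of
    the function itself is what makes a product such as f * D g continuous. *)
Lemma Rdifferentiable_continuous f w :
  Rdifferentiable_on Omega f -> Omega w -> {for w, continuous f}.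
Proof.
move=> hf Ow; have nO : nbhs w Omega by apply: open_nbhs_nbhs.
apply/continuous_ReIm; split.
  apply: (@C1_continuous _ _ Omega _
    (fun v x => complex.Re (rderive v f x)) _ nO) => xi v hv; split.
    by move=> x /(Rdifferentiable_derive hf hv) [].
  by case/continuous_ReIm: (hf xi v hv w Ow).2.
apply: (@C1_continuous _ _ Omega _
  (fun v x => complex.Im (rderive v f x)) _ nO) => xi v hv; split.
  by move=> x /(Rdifferentiable_derive hf hv) [].
by case/continuous_ReIm: (hf xi v hv w Ow).2.
Qed.

Lemma Rdifferentiable_ext f g : (forall w, Omega w -> f w = g w) ->
  Rdifferentiable_on Omega f -> Rdifferentiable_on Omega g.
Proof.
move=> fg hf; apply: (@Rdifferentiable_intro _ (fun v => rderive v f)).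
move=> xi v hv w Ow; split; last exact: (hf xi v hv w Ow).2.
apply: is_rderive_near (Rdifferentiable_derive hf hv Ow).
exact: near_open.
Qed.

Lemma Rdifferentiable_cst (c : C) : Rdifferentiable_on Omega (fun=> c).
Proof.
apply: (@Rdifferentiable_intro _ (fun _ _ => 0)) => xi v hv w Ow.
by split; [exact: is_rderive_cst|exact: continuousC_cst].
Qed.

Lemma RdifferentiableD f g : Rdifferentiable_on Omega f ->
  Rdifferentiable_on Omega g -> Rdifferentiable_on Omega (fun w => f w + g w).
Proof.
move=> hf hg; apply: (@Rdifferentiable_intro _
  (fun v x => rderive v f x + rderive v g x)) => xi v hv w Ow; split.
  by apply: is_rderiveD; apply: Rdifferentiable_derive hv Ow.
apply: continuousC_D; first exact: (hf xi v hv w Ow).2.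
exact: (hg xi v hv w Ow).2.
Qed.

Lemma RdifferentiableM f g : Rdifferentiable_on Omega f ->
  Rdifferentiable_on Omega g -> Rdifferentiable_on Omega (fun w => f w * g w).
Proof.
move=> hf hg; apply: (@Rdifferentiable_intro _
  (fun v x => f x * rderive v g x + g x * rderive v f x)) => xi v hv w Ow; split.
  by apply: is_rderiveM; apply: Rdifferentiable_derive hv Ow.
apply: continuousC_D; apply: continuousC_M.
- exact: Rdifferentiable_continuous hf Ow.
- exact: (hg xi v hv w Ow).2.
- exact: Rdifferentiable_continuous hg Ow.
- exact: (hf xi v hv w Ow).2.
Qed.

Lemma RdifferentiableV f : (forall w, Omega w -> f w != 0) ->
  Rdifferentiable_on Omega f -> Rdifferentiable_on Omega (fun w => (f w)^-1).
Proof.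
move=> f0 hf; have cf w (Ow : Omega w) := Rdifferentiable_continuous hf Ow.
apply: (@Rdifferentiable_intro _
  (fun v x => - (f x) ^- 2 * rderive v f x)) => xi v hv w Ow; split.
  apply: is_rderiveV; first exact: f0.
  exact: Rdifferentiable_derive hv Ow.
apply: continuousC_M; last exact: (hf xi v hv w Ow).2.
rewrite (_ : (fun x => _) = (fun x => (-1) * ((f x)^-1 * (f x)^-1))).
  apply: continuousC_M; first exact: continuousC_cst.
  by apply: continuousC_M; apply: continuousC_V => //; [exact: f0|exact: cf
    |exact: f0|exact: cf].
by apply/funext => x; rewrite mulN1r -expr2 exprVn.
Qed.

Lemma Rdifferentiable_exp f : Rdifferentiable_on Omega f ->
  Rdifferentiable_on Omega (fun w => cexp (f w)).
Proof.
move=> hf; apply: (@Rdifferentiable_intro _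
  (fun v x => cexp (f x) * rderive v f x)) => xi v hv w Ow; split.
  by apply: is_rderive_exp; apply: Rdifferentiable_derive hv Ow.
apply: continuousC_M; last exact: (hf xi v hv w Ow).2.
by apply: continuousC_exp; apply: Rdifferentiable_continuous hf Ow.
Qed.

Lemma Rdifferentiable_sum (I : Type) (r : seq I) (P : pred I) (F : I -> Cn -> C) :
  (forall i, P i -> Rdifferentiable_on Omega (F i)) ->
  Rdifferentiable_on Omega (fun w => \sum_(i <- r | P i) F i w).
Proof.
move=> hF; elim: r => [|i r IH].
  by rewrite (_ : (fun x => \sum_(j <- [::] | P j) F j x) = fun=> 0);
    last (by apply/funext => x; rewrite big_nil); exact: Rdifferentiable_cst.
rewrite (_ : (fun x => \sum_(j <- i :: r | P j) F j x) = fun x =>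
    if P i then F i x + \sum_(j <- r | P j) F j x else \sum_(j <- r | P j) F j x);
  last by apply/funext => x; rewrite big_cons.
case Pi: (P i); last exact: IH.
exact: (RdifferentiableD (hF i Pi) IH).
Qed.

Lemma Rdifferentiable_prod (I : Type) (r : seq I) (P : pred I) (F : I -> Cn -> C) :
  (forall i, P i -> Rdifferentiable_on Omega (F i)) ->
  Rdifferentiable_on Omega (fun w => \prod_(i <- r | P i) F i w).
Proof.
move=> hF; elim: r => [|i r IH].
  by rewrite (_ : (fun x => \prod_(j <- [::] | P j) F j x) = fun=> 1);
    last (by apply/funext => x; rewrite big_nil); exact: Rdifferentiable_cst.
rewrite (_ : (fun x => \prod_(j <- i :: r | P j) F j x) = fun x =>
    if P i then F i x * \prod_(j <- r | P j) F j x else \prod_(j <- r | P j) F j x);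
  last by apply/funext => x; rewrite big_cons.
case Pi: (P i); last exact: IH.
exact: (RdifferentiableM (hF i Pi) IH).
Qed.

End OnOpen.

Section Operators.
Variables (m : nat) (a : 'I_n -> 'I_(m + m) -> 'cV[R[i]]_(n + n)).
Variables (k : 'I_(m + m)) (Omega : set Cn) (oOmega : open Omega).

(** The operators are linear combinations, with coefficients depending on the
    point, of the 2n real partial derivatives; hence every pointwise rule for
    partial derivatives passes to them. *)
Lemma opX_linear f g h w (c d : C) :
  (forall (xi : 'I_n) v, v = dir_x R xi \/ v = dir_y R xi ->
     rderive v f w = c * rderive v g w + d * rderive v h w) ->
  opX a k f w = c * opX a k g w + d * opX a k h w.
Proof.
move=> fgh; rewrite /opX !mulr_sumr -big_split; apply: eq_bigr => xi _ /=.
rewrite /wirtinger /wirtinger_bar.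
rewrite (fgh xi (dir_x R xi)); last by left.
rewrite (fgh xi (dir_y R xi)); last by right.
move: (sysX a xi k w) (sysX a xi (swap_index k) w)^*%C => A B.
move: (rderive _ g w) (rderive _ g w) (rderive _ h w) (rderive _ h w).
by move=> gx gy hx hy; ring.
Qed.

Lemma opX_eq f g w : Omega w -> (forall x, Omega x -> f x = g x) ->
  Rdifferentiable_on Omega f -> opX a k g w = opX a k f w.
Proof.
move=> Ow fg hf; rewrite (@opX_linear _ f f _ 1 0); first by rewrite mul1r mul0r addr0.
move=> xi v hv; rewrite mul1r mul0r addr0; apply: is_rderiveE.
apply: is_rderive_near (Rdifferentiable_derive hf hv Ow).
exact: (near_open oOmega).
Qed.

Lemma opX_cst (c : C) w : opX a k (fun=> c) w = 0.
Proof.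
rewrite (@opX_linear _ (fun=> 0) (fun=> 0) _ 0 0) ?mul0r ?addr0 // => xi v hv.
by rewrite !mul0r addr0; apply: is_rderiveE; exact: is_rderive_cst.
Qed.

Lemma opX_D f g w : Omega w ->
  Rdifferentiable_on Omega f -> Rdifferentiable_on Omega g ->
  opX a k (fun x => f x + g x) w = opX a k f w + opX a k g w.
Proof.
move=> Ow hf hg; rewrite (@opX_linear _ f g _ 1 1) ?mul1r // => xi v hv.
rewrite !mul1r; apply: is_rderiveE.
by apply: is_rderiveD; apply: Rdifferentiable_derive hv Ow.
Qed.

Lemma opX_M f g w : Omega w ->
  Rdifferentiable_on Omega f -> Rdifferentiable_on Omega g ->
  opX a k (fun x => f x * g x) w = f w * opX a k g w + g w * opX a k f w.
Proof.
move=> Ow hf hg; apply: opX_linear => xi v hv; apply: is_rderiveE.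
by apply: is_rderiveM; apply: Rdifferentiable_derive hv Ow.
Qed.

Lemma opX_V f w : Omega w -> (forall x, Omega x -> f x != 0) ->
  Rdifferentiable_on Omega f ->
  opX a k (fun x => (f x)^-1) w = - (f w) ^- 2 * opX a k f w.
Proof.
move=> Ow f0 hf; rewrite (@opX_linear _ f f _ (- (f w) ^- 2) 0).
  by rewrite mul0r addr0.
move=> xi v hv; rewrite mul0r addr0; apply: is_rderiveE.
by apply: is_rderiveV; [exact: f0|apply: Rdifferentiable_derive hv Ow].
Qed.

Lemma opX_exp f w : Omega w -> Rdifferentiable_on Omega f ->
  opX a k (fun x => cexp (f x)) w = cexp (f w) * opX a k f w.
Proof.
move=> Ow hf; rewrite (@opX_linear _ f f _ (cexp (f w)) 0).
  by rewrite mul0r addr0.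
move=> xi v hv; rewrite mul0r addr0; apply: is_rderiveE.
by apply: is_rderive_exp; apply: Rdifferentiable_derive hv Ow.
Qed.

Lemma opX_scale (c : C) f w : Omega w -> Rdifferentiable_on Omega f ->
  opX a k (fun x => c * f x) w = c * opX a k f w.
Proof.
move=> Ow hf; rewrite (opX_M Ow (Rdifferentiable_cst oOmega c) hf).
by rewrite (opX_cst c w) mulr0 addr0.
Qed.

Lemma opX_sum (I : Type) (r : seq I) (P : pred I) (F : I -> Cn -> C) w :
  Omega w -> (forall i, P i -> Rdifferentiable_on Omega (F i)) ->
  opX a k (fun x => \sum_(i <- r | P i) F i x) w =
  \sum_(i <- r | P i) opX a k (F i) w.
Proof.
move=> Ow hF; elim: r => [|i r IH].
  by rewrite big_nil; rewrite (_ : (fun x => \sum_(j <- [::] | P j) F j x) = fun=> 0);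
    last (by apply/funext => x; rewrite big_nil); rewrite opX_cst.
rewrite big_cons; rewrite (_ : (fun x => \sum_(j <- i :: r | P j) F j x) = fun x =>
    if P i then F i x + \sum_(j <- r | P j) F j x else \sum_(j <- r | P j) F j x);
  last by apply/funext => x; rewrite big_cons.
case Pi: (P i); last exact: IH.
by rewrite (opX_D Ow (hF i Pi) (Rdifferentiable_sum oOmega _ hF)) IH.
Qed.

(** Logarithmic derivatives add up. *)
Lemma opX_prod_eigen (I : Type) (r : seq I) (P : pred I) (F : I -> Cn -> C)
    (c : I -> C) w :
  Omega w -> (forall i, P i -> Rdifferentiable_on Omega (F i)) ->
  (forall i, P i -> opX a k (F i) w = c i * F i w) ->
  opX a k (fun x => \prod_(i <- r | P i) F i x) w =
  (\sum_(i <- r | P i) c i) * \prod_(i <- r | P i) F i w.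
Proof.
move=> Ow hF hc; elim: r => [|i r IH].
  by rewrite !big_nil; rewrite (_ : (fun x => \prod_(j <- [::] | P j) F j x) = fun=> 1);
    last (by apply/funext => x; rewrite big_nil); rewrite opX_cst mul0r.
rewrite !big_cons; rewrite (_ : (fun x => \prod_(j <- i :: r | P j) F j x) = fun x =>
    if P i then F i x * \prod_(j <- r | P j) F j x else \prod_(j <- r | P j) F j x);
  last by apply/funext => x; rewrite big_cons.
case Pi: (P i); last exact: IH.
rewrite (opX_M Ow (hF i Pi) (Rdifferentiable_prod oOmega _ hF)) IH (hc i Pi).
move: (F i w) (c i) (\sum_(j <- r | P j) c j) (\prod_(j <- r | P j) F j w).
by move=> x y z t; ring.
Qed.

End Operators.
End Rdifferentiable.

(** * Linear forms and the functions rational in them *)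

Section LinearForms.
Variables (R : realType) (n : nat).
Notation C := R[i].
Notation Cn := 'cV[R[i]]_n.
Implicit Types (v w : Cn).

Lemma lin_formE (nu : 'cV[C]_(n + n)) w : lin_form nu w =
  \sum_(xi < n) (nu (lshift n xi) 0 * w xi 0 + nu (rshift n xi) 0 * (w xi 0)^*%C).
Proof.
rewrite /lin_form big_split_ord big_split /=; congr (_ + _); apply: eq_bigr => xi _.
  by rewrite /gamma_vec col_mxEu.
by rewrite /gamma_vec col_mxEd mxE.
Qed.

Lemma lin_formD (nu1 nu2 : 'cV[C]_(n + n)) w :
  lin_form (nu1 + nu2) w = lin_form nu1 w + lin_form nu2 w.
Proof.
by rewrite /lin_form -big_split; apply: eq_bigr => i _; rewrite mxE mulrDl.
Qed.

Lemma lin_formZ (c : C) (nu : 'cV[C]_(n + n)) w :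
  lin_form (c *: nu) w = c * lin_form nu w.
Proof.
by rewrite /lin_form mulr_sumr; apply: eq_bigr => i _; rewrite mxE mulrA.
Qed.

Lemma lin_form_line (nu : 'cV[C]_(n + n)) w v (t : R) :
  lin_form nu (w + t%:C *: v) = lin_form nu w + t%:C * lin_form nu v.
Proof.
rewrite !lin_formE mulr_sumr -big_split; apply: eq_bigr => xi _ /=.
have -> : ((w + t%:C *: v) xi 0)^*%C = (w xi 0)^*%C + t%:C * (v xi 0)^*%C.
  rewrite !mxE; case: (w xi 0) (v xi 0) => x y [z u].
  by apply/eqP; rewrite eq_complex /=; apply/andP; split; apply/eqP; ring.
rewrite !mxE; move: (nu _ 0) (nu _ 0) (w xi 0) (v xi 0) => A B x y.
move: (x^*%C) (y^*%C) => x' y'; by ring.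
Qed.

Lemma is_rderive_lin_form (nu : 'cV[C]_(n + n)) v w :
  is_rderive v (lin_form nu) w (lin_form nu v).
Proof.
have affine (b c : R) : is_derive (0 : R) (1 : R) (fun t : R => b + t * c) c.
  have h := is_deriveD (is_derive_cst b (0 : R) (1 : R))
    (is_deriveM (is_derive_id (0 : R) (1 : R)) (is_derive_cst c (0 : R) (1 : R))).
  by apply: (is_derive_eq h); rewrite scaler0 add0r add0r /GRing.scale /= mulr1.
split.
  rewrite (_ : re_line _ _ _ = fun t : R =>
    complex.Re (lin_form nu w) + t * complex.Re (lin_form nu v)).
    exact: affine.
  by apply/funext => t; rewrite /re_line lin_form_line ReD ReM /= mul0r subr0.
rewrite (_ : im_line _ _ _ = fun t : R =>
  complex.Im (lin_form nu w) + t * complex.Im (lin_form nu v)).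
  exact: affine.
by apply/funext => t; rewrite /im_line lin_form_line ImD ImM /= mul0r addr0.
Qed.

Lemma rderive_lin_form (nu : 'cV[C]_(n + n)) v :
  rderive v (lin_form nu) = fun=> lin_form nu v.
Proof. by apply/funext => w; apply: is_rderiveE; exact: is_rderive_lin_form. Qed.

Lemma Rdifferentiable_lin_form (Omega : set Cn) (nu : 'cV[C]_(n + n)) :
  Rdifferentiable_on Omega (lin_form nu).
Proof.
move=> xi v _ w _; split.
  exact: is_rderive_rderivable (is_rderive_lin_form nu v w).
by rewrite rderive_lin_form; exact: continuousC_cst.
Qed.

Lemma twice_Rdifferentiable_lin_form (nu : 'cV[C]_(n + n)) :
  twice_Rdifferentiable (lin_form nu).
Proof.
split=> [|xi]; first exact: Rdifferentiable_lin_form.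
by rewrite !rderive_lin_form; split; apply: Rdifferentiable_cst; exact: openT.
Qed.

Lemma wirtinger_lin_form (nu : 'cV[C]_(n + n)) (xi : 'I_n) w :
  wirtinger xi (lin_form nu) w = nu (lshift n xi) 0 /\
  wirtinger_bar xi (lin_form nu) w = nu (rshift n xi) 0.
Proof.
have dE (c : C) : lin_form nu (c *: delta_mx xi 0) =
    nu (lshift n xi) 0 * c + nu (rshift n xi) 0 * c^*%C.
  rewrite lin_formE (bigD1 xi) //= big1 => [|j /negbTE ij].
    by rewrite !mxE !eqxx mulr1 addr0.
  by rewrite !mxE ij /= mulr0 rmorph0 !mulr0 addr0.
have xE : lin_form nu (dir_x R xi) = nu (lshift n xi) 0 + nu (rshift n xi) 0.
  by rewrite /dir_x -[delta_mx _ _]scale1r dE rmorph1 !mulr1.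
have yE : lin_form nu (dir_y R xi) =
    'i%C * (nu (lshift n xi) 0 - nu (rshift n xi) 0).
  rewrite /dir_y dE (_ : ('i%C)^*%C = - 'i%C :> C); first by ring.
  by apply/eqP; rewrite eq_complex /= oppr0 !eqxx.
have ii : 'i%C * 'i%C = -1 :> C by rewrite -expr2 sqr_i.
have n2 : (2 : C) != 0 by rewrite pnatr_eq0.
rewrite /wirtinger /wirtinger_bar !rderive_lin_form xE yE mulrA ii.
by split; field.
Qed.

End LinearForms.

Section RationalFunctions.
Variables (R : realType) (m n : nat).
Notation C := R[i].
Notation Cn := 'cV[R[i]]_n.
Variable a : 'I_n -> 'I_(m + m) -> 'cV[R[i]]_(n + n).

Lemma lin_form_bar_coef tau k (w : Cn) :
  lin_form (bar_coef a tau k) w = (sysX a tau k w)^*%C.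
Proof.
rewrite lin_formE /sysX rmorph_sum; apply: eq_bigr => xi _ /=.
rewrite rmorphD !rmorphM /= conjcK /bar_coef col_mxEu col_mxEd !mxE.
by rewrite addrC.
Qed.

(** The matrices are the operators restricted to linear forms, acting on the
    coefficient vectors. *)
Lemma opX_lin_form k (nu : 'cV[C]_(n + n)) :
  opX a k (lin_form nu) = lin_form (matA a k *m nu).
Proof.
apply/funext => w; rewrite /opX.
under eq_bigr do rewrite !(wirtinger_lin_form nu _ w).1 !(wirtinger_lin_form nu _ w).2.
rewrite [RHS]/lin_form.
under [RHS]eq_bigr do rewrite mxE mulr_suml.
rewrite exchange_big big_split_ord /= big_split /=; congr (_ + _); apply: eq_bigr => tau _.
  rewrite /sysX -lin_formE /lin_form mulr_suml; apply: eq_bigr => rho _.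
  by rewrite /matA row_mxEl mxE mulrAC.
rewrite -lin_form_bar_coef /lin_form mulr_suml; apply: eq_bigr => rho _.
by rewrite /matA row_mxEr mxE mulrAC.
Qed.

Variables (Omega : set Cn) (oOmega : open Omega).

(* Unification must not unfold the operators into sums. *)
Local Opaque opX.

(** A domain for iterated operators: it contains the quotients attached to Jordan
    chains, its members are differentiable and the operators map it to itself.
    The last constructor is there because these quotients are only specified on
    Omega. *)
Inductive rational_on : (Cn -> C) -> Prop :=
| rational_lin nu : rational_on (lin_form nu)
| rational_cst c : rational_on (fun=> c)
| rational_add f g : rational_on f -> rational_on g ->
    rational_on (fun w => f w + g w)
| rational_mul f g : rational_on f -> rational_on g ->
    rational_on (fun w => f w * g w)
| rational_inv f : (forall w, Omega w -> f w != 0) -> rational_on f ->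
    rational_on (fun w => (f w)^-1)
| rational_ext f g : (forall w, Omega w -> f w = g w) -> rational_on f ->
    rational_on g.

Lemma rational_sum (I : Type) (r : seq I) (P : pred I) (F : I -> Cn -> C) :
  (forall i, P i -> rational_on (F i)) ->
  rational_on (fun w => \sum_(i <- r | P i) F i w).
Proof.
move=> hF; elim: r => [|i r IH].
  by apply: rational_ext (rational_cst 0) => w _; rewrite big_nil.
case Pi: (P i); last by apply: rational_ext IH => w _; rewrite big_cons Pi.
by apply: rational_ext (rational_add (hF i Pi) IH) => w _; rewrite big_cons Pi.
Qed.

Lemma rational_Rdifferentiable f : rational_on f -> Rdifferentiable_on Omega f.
Proof.
elim=> {f} [nu|c|f g _ hf _ hg|f g _ hf _ hg|f f0 _ hf|f g fg _ hf].
- exact: Rdifferentiable_lin_form.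
- exact: Rdifferentiable_cst.
- exact: RdifferentiableD.
- exact: RdifferentiableM.
- exact: RdifferentiableV.
- exact: Rdifferentiable_ext hf.
Qed.

Lemma rational_opX k f : rational_on f -> rational_on (opX a k f).
Proof.
have d g := @rational_Rdifferentiable g.
elim=> {f} [nu|c|f g rf hf rg hg|f g rf hf rg hg|f f0 rf hf|f g fg rf hf].
- rewrite opX_lin_form; exact: rational_lin.
- by apply: rational_ext (rational_cst 0) => w _; rewrite opX_cst.
- apply: rational_ext (rational_add hf hg) => w Ow.
  by rewrite (opX_D a k Ow (d _ rf) (d _ rg)).
- apply: rational_ext (rational_add (rational_mul rf hg) (rational_mul rg hf)) => w Ow.
  by rewrite (opX_M a k Ow (d _ rf) (d _ rg)).
- have rV := rational_inv f0 rf.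
  apply: rational_ext
    (rational_mul (rational_mul (rational_cst (-1)) (rational_mul rV rV)) hf) => w Ow.
  by rewrite (opX_V a k Ow f0 (d _ rf)) mulN1r -expr2 exprVn.
- by apply: rational_ext hf => w Ow; rewrite (opX_eq a k oOmega Ow fg (d _ rf)).
Qed.

Hypothesis solv : completely_solvable a.

(** Complete solvability is an identity for functions on the whole space, while a
    rational function lives on Omega only.  It applies to the linear forms, and
    the commutator of two derivations is a derivation, so its vanishing
    propagates through sums, products and inverses. *)
Lemma rational_opX_comm k l f w : rational_on f -> Omega w ->
  opX a k (opX a l f) w = opX a l (opX a k f) w.
Proof.
have d g := @rational_Rdifferentiable g; have X j g := @rational_opX j g.
move=> rf Ow.
elim: rf => {f} [nu|c|f g rf hf rg hg|f g rf hf rg hg|f f0 rf hf|f g fg rf hf].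
- by apply/eqP; rewrite -subr_eq0; apply/eqP/solv/twice_Rdifferentiable_lin_form.
- have cst0 j : opX a j (fun=> c) = fun=> 0 by apply/funext => x; exact: opX_cst.
  by rewrite !cst0 !opX_cst.
- have E j i : opX a j (opX a i (fun x => f x + g x)) w =
      opX a j (opX a i f) w + opX a j (opX a i g) w.
    have dXf := d _ (X i _ rf); have dXg := d _ (X i _ rg).
    rewrite -[RHS](opX_D a j Ow dXf dXg).
    apply: (opX_eq a j oOmega Ow _ (RdifferentiableD oOmega dXf dXg)) => x Ox.
    by rewrite (opX_D a i Ox (d _ rf) (d _ rg)).
  by rewrite (E k l) (E l k) hf hg.
- have E j i : opX a j (opX a i (fun x => f x * g x)) w =
      f w * opX a j (opX a i g) w + opX a i g w * opX a j f w +
      (g w * opX a j (opX a i f) w + opX a i f w * opX a j g w).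
    have df := d _ rf; have dg := d _ rg.
    have dXf := d _ (X i _ rf); have dXg := d _ (X i _ rg).
    have d1 := RdifferentiableM oOmega df dXg.
    have d2 := RdifferentiableM oOmega dg dXf.
    etransitivity.
      apply: (opX_eq a j oOmega Ow _ (RdifferentiableD oOmega d1 d2)) => x Ox.
      by rewrite (opX_M a i Ox df dg).
    by rewrite (opX_D a j Ow d1 d2) (opX_M a j Ow df dXg) (opX_M a j Ow dg dXf).
  rewrite (E k l) (E l k) hf hg; move: (opX a k f w) (opX a l f w) (opX a k g w) (opX a l g w).
  move: (opX a l (opX a k f) w) (opX a l (opX a k g) w) (f w) (g w).
  by move=> *; ring.
- have rV := rational_inv f0 rf.
  have E j i : opX a j (opX a i (fun x => (f x)^-1)) w =
      - (f w)^-1 ^+ 2 * opX a j (opX a i f) w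
      + 2 * (f w)^-1 ^+ 3 * (opX a i f w * opX a j f w).
    have df := d _ rf; have dXf := d _ (X i _ rf); have dV := d _ rV.
    have dVV := RdifferentiableM oOmega dV dV.
    have dN := RdifferentiableM oOmega (Rdifferentiable_cst oOmega (-1)) dVV.
    have -> : opX a j (opX a i (fun x => (f x)^-1)) w =
        opX a j (fun x => (-1 * ((f x)^-1 * (f x)^-1)) * opX a i f x) w.
      apply: (opX_eq a j oOmega Ow _ (RdifferentiableM oOmega dN dXf)) => x Ox.
      by rewrite (opX_V a i Ox f0 df) mulN1r -expr2 exprVn.
    rewrite (opX_M a j Ow dN dXf) (opX_scale a j oOmega (-1) Ow dVV).
    rewrite (opX_M a j Ow dV dV) (opX_V a j Ow f0 df) -exprVn.
    move: ((f w)^-1) (opX a j (opX a i f) w) (opX a i f w) (opX a j f w).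
    by move=> x y z t; ring.
  by rewrite (E k l) (E l k) hf [opX a l f w * _]mulrC.
- have E j i : opX a j (opX a i g) w = opX a j (opX a i f) w.
    apply: (opX_eq a j oOmega Ow _ (d _ (X i _ rf))) => x Ox.
    by rewrite (opX_eq a i oOmega Ox fg (d _ rf)).
  by rewrite (E k l) (E l k).
Qed.

End RationalFunctions.

(** * Quotients attached to a Jordan chain *)

(** With L p the linear form of nu p, the defining relations say that the formal
    series of the L p t^p / p! is L 0 times the exponential of the series of the
    Phi d t^(d+1) / (d+1)!.  The operator multiplies the first series by lam + t
    and L 0 by lam, so it sends the exponent to t: it maps Phi 0 to 1 and the
    other Phi d to 0.  The index of Phi is one less than that of the quotient in
    the theorem, so that the binomial coefficients need no subtraction. *)
Section JordanChain.
Variables (R : realType) (m n : nat).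
Notation C := R[i].
Notation Cn := 'cV[R[i]]_n.
Variable a : 'I_n -> 'I_(m + m) -> 'cV[R[i]]_(n + n).
Variables (Omega : set Cn) (oOmega : open Omega).
Variables (z : 'I_(m + m)) (lam : C) (nu : nat -> 'cV[C]_(n + n)) (N : nat).
Variable (Phi : nat -> Cn -> C).
Hypothesis A_nu0 : matA a z *m nu 0%N = lam *: nu 0%N.
Hypothesis A_nuS : forall p, (p < N)%N ->
  matA a z *m nu p.+1 = lam *: nu p.+1 + p.+1%:R *: nu p.
Hypothesis nu0_neq0 : forall w, Omega w -> lin_form (nu 0%N) w != 0.
Hypothesis PhiE : forall p, (p < N)%N -> forall w, Omega w ->
  lin_form (nu p.+1) w =
  \sum_(d < p.+1) 'C(p, d)%:R * Phi d w * lin_form (nu (p - d)%N) w.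

Local Opaque opX.

(** The relation for p has the term Phi p * L 0, the other quotients in it being
    of smaller index: solving for Phi p only divides by L 0. *)
Lemma chain_quotient_rational p : (p < N)%N -> rational_on Omega (Phi p).
Proof.
elim/ltn_ind: p => p IH pN.
have r0 := rational_inv nu0_neq0 (rational_lin Omega (nu 0%N)).
have rd (d : 'I_p) : true -> rational_on Omega
    (fun w => 'C(p, d)%:R * Phi d w * lin_form (nu (p - d)%N) w).
  move=> _; apply: rational_mul (rational_lin _ _).
  by apply: rational_mul (rational_cst _ _) (IH _ _ _); last apply: ltn_trans pN.
have rs := rational_mul (rational_cst _ (-1)) (rational_sum (index_enum 'I_p) rd).
apply: rational_ext (rational_mul (rational_add (rational_lin _ (nu p.+1)) rs) r0).
move=> w Ow; rewrite (PhiE pN Ow) big_ord_recr /= binn subnn mul1r mulN1r.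
by rewrite [X in X - _]addrC addrK mulfK // nu0_neq0.
Qed.

Lemma opX_chain_form p w : (p <= N)%N ->
  opX a z (lin_form (nu p)) w =
  lam * lin_form (nu p) w + p%:R * lin_form (nu p.-1) w.
Proof.
move=> pN; rewrite opX_lin_form; case: p pN => [_|p pN].
  by rewrite A_nu0 lin_formZ mul0r addr0.
by rewrite A_nuS // lin_formD !lin_formZ.
Qed.

(** Applying the operator to the relation for p and cancelling what the linear
    forms contribute leaves L p = sum of 'C(p, d) L (p - d) X(Phi d), from which
    X(Phi p) is read off by induction. *)
Lemma opX_chain_quotient p w : (p < N)%N -> Omega w ->
  opX a z (Phi p) w = (p == 0%N)%:R.
Proof.
move=> + Ow; elim/ltn_ind: p => p IH pN.
pose L q := lin_form (nu q) w.
have dL q : Rdifferentiable_on Omega (lin_form (nu q)).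
  exact: Rdifferentiable_lin_form.
have dPhi d : (d < p.+1)%N -> Rdifferentiable_on Omega (Phi d).
  move=> dp; apply: (rational_Rdifferentiable oOmega).
  by apply: chain_quotient_rational; apply: leq_trans pN.
have dM (d : 'I_p.+1) : Rdifferentiable_on Omega
    (fun w => Phi d w * lin_form (nu (p - d)%N) w).
  by apply: RdifferentiableM => //; exact: dPhi.
have dCM (d : 'I_p.+1) : Rdifferentiable_on Omega
    (fun w => 'C(p, d)%:R * (Phi d w * lin_form (nu (p - d)%N) w)).
  by apply: RdifferentiableM => //; exact: Rdifferentiable_cst.
have lhs : opX a z (lin_form (nu p.+1)) w = lam * L p.+1 + p.+1%:R * L p.
  by rewrite opX_chain_form.
have rhs : opX a z (lin_form (nu p.+1)) w =
    \sum_(d < p.+1) 'C(p, d)%:R * (Phi d w *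
       (lam * L (p - d)%N + (p - d)%:R * L (p - d).-1)
       + L (p - d)%N * opX a z (Phi d) w).
  transitivity (opX a z (fun w => \sum_(d < p.+1)
      'C(p, d)%:R * (Phi d w * lin_form (nu (p - d)%N) w)) w).
    apply: (opX_eq a z oOmega Ow).
      move=> x Ox; rewrite (PhiE pN Ox); apply: eq_bigr => d _.
      by rewrite mulrA.
    by apply: Rdifferentiable_sum => // d _; exact: dCM.
  rewrite (opX_sum a z oOmega _ Ow (fun d _ => dCM d)); apply: eq_bigr => d _.
  rewrite (opX_scale a z oOmega _ Ow (dM d)).
  rewrite (opX_M a z Ow (dPhi d (ltn_ord d)) (dL _)).
  by rewrite opX_chain_form // (leq_trans (leq_subr _ _)) // ltnW.
have LE : L p.+1 = \sum_(d < p.+1) 'C(p, d)%:R * Phi d w * L (p - d)%N.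
  exact: PhiE.
(* The nilpotent part of the operator turns the relation for p into p times the
   relation for p - 1, as (p - d) 'C(p, d) = p 'C(p - 1, d). *)
have lower : \sum_(d < p.+1) 'C(p, d)%:R * (Phi d w * ((p - d)%:R * L (p - d).-1))
    = p%:R * L p.
  rewrite big_ord_recr /= subnn mul0r !mulr0 addr0.
  case: {IH dM dCM lhs rhs LE dPhi} p pN => [|q] qN; first by rewrite big_ord0 mul0r.
  rewrite /L (PhiE (ltnW qN) Ow) mulr_sumr; apply: eq_bigr => d _.
  have dq : (d <= q)%N by rewrite -ltnS.
  rewrite subSn //= !mulrA -[in RHS]natrM (mul_bin_down q.+1 d) subSn //.
  by rewrite natrM [_ * 'C(_, _)%:R]mulrC -!mulrA; congr (_ * _); rewrite mulrCA.
have key : L p = \sum_(d < p.+1) 'C(p, d)%:R * (L (p - d)%N * opX a z (Phi d) w).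
  apply: (addrI (lam * L p.+1 + p%:R * L p)).
  have -> : lam * L p.+1 + p%:R * L p + L p = opX a z (lin_form (nu p.+1)) w.
    by rewrite lhs -natr1 mulrDl mul1r addrA.
  rewrite rhs LE -lower mulr_sumr -!big_split; apply: eq_bigr => d _ /=.
  by move: 'C(p, d)%:R (Phi d w) (L _) (L _) (p - d)%:R (opX _ _ _ _) => *; ring.
rewrite big_ord_recr /= binn subnn mul1r in key.
case: {dM dCM lhs rhs LE lower dPhi} p pN IH key => [|q] qN IH key.
  rewrite big_ord0 add0r in key.
  by apply: (mulfI (nu0_neq0 Ow)); rewrite mulr1 -key.
rewrite big_ord_recl /= bin0 mul1r subn0 (IH 0%N) //= ?mulr1 in key; last exact: leq_ltn_trans qN.
rewrite big1 ?addr0 in key; last first.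
  move=> d _; rewrite IH ?mulr0 //= /bump /=; first by rewrite add1n ltnS.
  by rewrite add1n; apply: leq_trans qN; rewrite ltnS ltnW // ltnS.
apply: (mulfI (nu0_neq0 Ow)); rewrite mulr0.
by apply: (addrI (L q.+1)); rewrite addr0 -key.
Qed.

End JordanChain.

(** * Constancy, power branches, and counting *)

Section FirstIntegrals.
Variables (R : realType) (m n : nat).
Notation C := R[i].
Notation Cn := 'cV[R[i]]_n.
Variable a : 'I_n -> 'I_(m + m) -> 'cV[R[i]]_(n + n).
Variables (Omega : set Cn) (oOmega : open Omega).

Local Opaque opX.

(** As the operators commute, X_k f is annihilated by X_zeta when X_zeta f is
    constant; the only such functions that are not first integrals are the
    constant ones. *)
Lemma opX_const_of_not_first_integral (zeta : 'I_m) k (f : Cn -> C) (c : C) :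
  completely_solvable a -> rational_on Omega f ->
  (forall w, Omega w -> opX a (lshift m zeta) f w = c) ->
  ~ ode_first_integral a zeta Omega (opX a k f) ->
  exists mu, forall w, Omega w -> opX a k f w = mu.
Proof.
move=> solv rf fc nfi; have [[w0 Ow0]|none] := pselect (exists w, Omega w); last first.
  by exists 0 => w Ow; exfalso; apply: none; exists w.
exists (opX a k f w0) => w Ow; apply: contrapT => ne; apply: nfi; split.
- exact: (rational_Rdifferentiable oOmega (rational_opX a oOmega k rf)).
- by exists w, w0.
move=> x Ox; rewrite (rational_opX_comm oOmega solv _ _ rf Ox).
have cf y (Oy : Omega y) := esym (fc y Oy).
by rewrite (opX_eq a k oOmega Ox cf (Rdifferentiable_cst oOmega c)) opX_cst.
Qed.

Lemma cexp_neq0 (u : C) : cexp u != 0.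
Proof.
rewrite /cexp mulf_neq0 //.
  by rewrite eq_complex /= eqxx andbT gt_eqF // expR_gt0.
rewrite eq_complex /=; apply/negP => /andP[/eqP c0 /eqP s0].
by have := cos2Dsin2 (complex.Im u); rewrite c0 s0 expr0n addr0 => /eqP; rewrite eq_sym oner_eq0.
Qed.

Lemma Rdifferentiable_power_branch (g P : Cn -> C) (h : C) :
  power_branch Omega g h P -> Rdifferentiable_on Omega P.
Proof.
move=> hP xi v hv w Ow; have [U [L [oU Uw UO dL hL]]] := hP w Ow.
suff dP : Rdifferentiable_on U P by exact: (dP xi v hv w Uw).
apply: (Rdifferentiable_ext oU (f := fun x => cexp (h * L x))).
  by move=> x /hL [].
exact: (Rdifferentiable_exp oU (RdifferentiableM oU (Rdifferentiable_cst oU h) dL)).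
Qed.

(** A local logarithm of an eigenfunction g is mapped by the operator to the
    eigenvalue c, so h times it exponentiates to eigenvalue h c. *)
Lemma opX_power_branch k (g P : Cn -> C) (h c : C) w :
  power_branch Omega g h P -> Omega w -> opX a k g w = c * g w ->
  opX a k P w = h * c * P w.
Proof.
move=> hP Ow gc; have [U [L [oU Uw UO dL hL]]] := hP w Ow.
have dhL := RdifferentiableM oU (Rdifferentiable_cst oU h) dL.
have gL x (Ux : U x) : cexp (L x) = g x := (hL x Ux).1.
have PL x (Ux : U x) : cexp (h * L x) = P x := esym (hL x Ux).2.
have gE : opX a k g w = g w * opX a k L w.
  rewrite (opX_eq a k oU Uw gL (Rdifferentiable_exp oU dL)).
  by rewrite (opX_exp a k Uw dL) gL.
have g0 : g w != 0 by rewrite -(gL w Uw) cexp_neq0.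
have Lc : opX a k L w = c by apply: (mulfI g0); rewrite -gE gc mulrC.
rewrite (opX_eq a k oU Uw PL (Rdifferentiable_exp oU dhL)).
by rewrite (opX_exp a k Uw dhL) (opX_scale a k oU h Uw dL) Lc PL // mulrC.
Qed.

End FirstIntegrals.

Lemma exists_bounded_sum (r : nat) (t : 'I_r -> nat) (M : nat) :
  (M <= \sum_i t i)%N ->
  exists2 e : 'I_r -> nat, (forall i, e i <= t i)%N & (\sum_i e i = M)%N.
Proof.
elim: M => [_|M IH Mt]; first by exists (fun=> 0%N) => //; rewrite big1.
have [e et eM] := IH (ltnW Mt).
have [i ei] : exists i, (e i < t i)%N.
  apply/existsP; apply: contraLR Mt; rewrite negb_exists -leqNgt -eM => /forallP te.
  by apply: leq_sum => i _; rewrite leqNgt.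
exists (fun j => e j + (j == i))%N => [j|].
  by have [->|_] := eqVneq j i; rewrite ?addn1 ?addn0.
rewrite big_split /= eM (bigD1 i) //= eqxx big1 ?addn0 ?addn1 // => j /negbTE ->.
by [].
Qed.

Lemma sum_ord_lt (r alpha : nat) : (alpha <= r)%N ->
  (\sum_(xi < r | (xi < alpha)%N) 1 = alpha)%N.
Proof. by move=> ar; rewrite -(big_ord_widen r (fun=> 1%N) ar) sum1_card card_ord. Qed.

Lemma exists_exponents (r N : nat) (s : 'I_r -> nat) :
  (forall l, 0 < s l)%N -> (N <= \sum_(l < r) s l)%N ->
  exists (alpha : nat) (eps : 'I_r -> nat),
    [/\ (alpha <= r)%N,
        forall xi : 'I_r, (xi < alpha)%N -> (eps xi <= s xi - 1)%N
      & (\sum_(xi < r | (xi < alpha)%N) eps xi + alpha = N)%N].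
Proof.
move=> s0 Ns.
(* If N < r, then N chains with one unknown each suffice; otherwise all chains
   are used and the remaining N - r unknowns are spread over them. *)
have [Nr|rN] := ltnP N r.
  by exists N, (fun=> 0%N); split => //; [exact: ltnW|rewrite big1].
have : (N - r <= \sum_(l < r) (s l - 1))%N.
  rewrite leq_subLR; apply: leq_trans Ns _.
  rewrite (eq_bigr (fun l => 1 + (s l - 1))%N) => [|l _]; last by rewrite subnKC.
  by rewrite big_split /= sum1_card card_ord.
case/exists_bounded_sum => eps h1 h2; exists r, eps; split => //.
rewrite (eq_bigl xpredT) => [|l]; last by rewrite ltn_ord.
by rewrite h2 subnK.
Qed.

(** More unknowns than equations; the unknowns are indexed by a subset of a finite
    type, which spares numbering the pairs (q, xi) in the application. *)
Lemma nontrivial_solution_of_card (K : fieldType) (T : finType) (A : {pred T})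
    (p : nat) (c : 'I_p -> T -> K) : (p < #|A|)%N ->
  exists h : T -> K, (exists2 t, t \in A & h t != 0) /\
    forall k, \sum_(t in A) c k t * h t = 0.
Proof.
move=> pA; pose M : 'M[K]_(#|A|, p) := \matrix_(i, k) c k (enum_val i).
have ker0 : kermx M != 0.
  rewrite kermx_eq0 /row_free; apply/negP => /eqP rM.
  by have := rank_leq_col M; rewrite rM leqNgt pA.
pose v := nz_row (kermx M); have v0 : v != 0 by rewrite nz_row_eq0.
have vM : v *m M = 0 by apply/sub_kermxP; exact: nz_row_sub.
pose h t := \sum_(i | enum_val i == t) v 0 i.
have hE i : h (enum_val i) = v 0 i.
  rewrite /h (eq_bigl (pred1 i)) ?big_pred1_eq // => j /=.
  by rewrite (inj_eq enum_val_inj).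
exists h; split.
  have /rV0Pn [i vi] := v0; exists (enum_val i); first exact: enum_valP.
  by rewrite hE.
move=> k; rewrite big_enum_val.
transitivity ((v *m M) 0 k); last by rewrite vM mxE.
by rewrite mxE; apply: eq_bigr => i _; rewrite hE mxE mulrC.
Qed.

(** * The first integral *)

Lemma nontrivial_exponents (K : fieldType) (r alpha p : nat) (eps : 'I_r -> nat)
    (lambda : 'I_p -> 'I_r -> K) (mu : 'I_p -> nat -> 'I_r -> K) :
  (alpha <= r)%N -> (p < \sum_(xi < r | (xi < alpha)%N) eps xi + alpha)%N ->
  exists h : nat -> 'I_r -> K,
    (exists (xi : 'I_r) (q : nat),
      [/\ (xi < alpha)%N, (q <= eps xi)%N & h q xi <> 0]) /\
    forall k, \sum_(xi < r | (xi < alpha)%N)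
      (lambda k xi * h 0%N xi
       + \sum_(1 <= q < (eps xi).+1) mu k q xi * h q xi) = 0.
Proof.
move=> ar pN; pose B := (\max_xi eps xi)%N.
have epsB xi : (eps xi <= B)%N by exact: leq_bigmax.
pose A := [pred t : 'I_r * 'I_B.+1 | (t.1 < alpha)%N && (t.2 < (eps t.1).+1)%N].
have cardA : (p < #|A|)%N.
  rewrite -sum1_card (eq_bigl (fun t : 'I_r * 'I_B.+1 => (t.1 < alpha)%N && (t.2 < (eps t.1).+1)%N)) //.
  rewrite -(pair_big_dep (fun xi : 'I_r => (xi < alpha)%N)
    (fun xi (q : 'I_B.+1) => (q < (eps xi).+1)%N) (fun _ _ => 1%N)) /=.
  rewrite (eq_bigr (fun xi => eps xi + 1)%N) => [|xi _].
    by rewrite big_split /= sum_ord_lt.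
  by rewrite sum_ord_lt ?addn1 // ltnS.
pose c k (t : 'I_r * 'I_B.+1) := if t.2 == 0%N :> nat then lambda k t.1 else mu k t.2 t.1.
have [h' [[t tA ht] h'0]] := @nontrivial_solution_of_card K _ A p c cardA.
exists (fun q xi => h' (xi, inord q)); split.
  case: t tA ht => xi q; rewrite inE /= ltnS => /andP[xia qe] ht.
  by exists xi, q; split => //; rewrite inord_val; apply/eqP.
move=> k; rewrite -[RHS](h'0 k).
rewrite [RHS](eq_bigl (fun t : 'I_r * 'I_B.+1 => (t.1 < alpha)%N && (t.2 < (eps t.1).+1)%N)) //.
rewrite [RHS](eq_bigr (fun t => c k (t.1, t.2) * h' (t.1, t.2))) => [|[] //].
rewrite -(pair_big_dep (fun xi : 'I_r => (xi < alpha)%N)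
    (fun xi (q : 'I_B.+1) => (q < (eps xi).+1)%N)
    (fun xi q => c k (xi, q) * h' (xi, q))) /=.
apply: eq_bigr => xi _.
pose G q := (if q == 0%N then lambda k xi else mu k q xi) * h' (xi, inord q).
rewrite (eq_bigr (fun q : 'I_B.+1 => G q)) => [|q _]; last by rewrite /G inord_val.
rewrite -(big_ord_widen _ G) ?ltnS // -(big_mkord predT G) [RHS]big_ltn //.
by congr (_ + _); apply: eq_big_nat => q /andP[q0 _]; rewrite /G gtn_eqF.
Qed.

Section FirstIntegral.
Variables (R : realType) (m n r : nat).
Notation C := R[i].
Notation Cn := 'cV[R[i]]_n.
Variable a : 'I_n -> 'I_(m + m) -> 'cV[R[i]]_(n + n).
Variables (Omega : set Cn) (oOmega : open Omega).

Local Opaque opX.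

(** Each factor is an eigenfunction of X_k: the power contributes lambda * h 0 and
    the exponential the sum of the mu * h q.  The linear system for h says that
    the total eigenvalue of the product vanishes. *)
Lemma autonomous_first_integral_prod (alpha : nat) (eps : 'I_r -> nat)
    (g : 'I_r -> Cn -> C) (lambda : 'I_(m + m) -> 'I_r -> C)
    (Psi : nat -> 'I_r -> Cn -> C) (mu : 'I_(m + m) -> nat -> 'I_r -> C)
    (h : nat -> 'I_r -> C) (P : 'I_r -> Cn -> C) :
  (forall k (xi : 'I_r) w, (xi < alpha)%N -> Omega w ->
     opX a k (g xi) w = lambda k xi * g xi w) ->
  (forall (xi : 'I_r) q, (xi < alpha)%N -> (0 < q < (eps xi).+1)%N ->
     Rdifferentiable_on Omega (Psi q xi) /\
     forall k w, Omega w -> opX a k (Psi q xi) w = mu k q xi) ->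
  (forall xi : 'I_r, (xi < alpha)%N ->
     power_branch Omega (g xi) (h 0%N xi) (P xi)) ->
  (forall k, \sum_(xi < r | (xi < alpha)%N)
     (lambda k xi * h 0%N xi
      + \sum_(1 <= q < (eps xi).+1) mu k q xi * h q xi) = 0) ->
  autonomous_first_integral a Omega
    (fun w => \prod_(xi < r | (xi < alpha)%N)
       (P xi w * cexp (\sum_(1 <= q < (eps xi).+1) h q xi * Psi q xi w))).
Proof.
move=> hg hPsi hP hh.
pose T xi q w := h q xi * Psi q xi w.
pose E xi w := \sum_(1 <= q < (eps xi).+1 | (0 < q < (eps xi).+1)%N) T xi q w.
have EE xi w : E xi w = \sum_(1 <= q < (eps xi).+1) h q xi * Psi q xi w.
  by rewrite [RHS]big_nat_cond /E; apply: eq_bigl => q; rewrite andbT.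
have dT (xi : 'I_r) q : (xi < alpha)%N -> (0 < q < (eps xi).+1)%N ->
    Rdifferentiable_on Omega (T xi q).
  move=> xia qe.
  exact: (RdifferentiableM oOmega (Rdifferentiable_cst oOmega _) (hPsi xi q xia qe).1).
have dE (xi : 'I_r) (xia : (xi < alpha)%N) : Rdifferentiable_on Omega (E xi).
  exact: (Rdifferentiable_sum oOmega _ (fun q => dT xi q xia)).
have dP (xi : 'I_r) (xia : (xi < alpha)%N) : Rdifferentiable_on Omega (P xi).
  exact: (Rdifferentiable_power_branch (hP xi xia)).
pose F (xi : 'I_r) w := P xi w * cexp (E xi w).
have dF (xi : 'I_r) (xia : (xi < alpha)%N) : Rdifferentiable_on Omega (F xi).
  exact: (RdifferentiableM oOmega (dP xi xia) (Rdifferentiable_exp oOmega (dE xi xia))).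
rewrite (_ : (fun w => _) = fun w => \prod_(xi < r | (xi < alpha)%N) F xi w); last first.
  by apply/funext => w; apply: eq_bigr => xi _; rewrite /F EE.
split; first exact: (Rdifferentiable_prod oOmega _ dF).
move=> k w Ow.
pose c xi := lambda k xi * h 0%N xi + \sum_(1 <= q < (eps xi).+1) mu k q xi * h q xi.
have Fc (xi : 'I_r) (xia : (xi < alpha)%N) : opX a k (F xi) w = c xi * F xi w.
  rewrite (opX_M a k Ow (dP xi xia) (Rdifferentiable_exp oOmega (dE xi xia))).
  rewrite (opX_exp a k Ow (dE xi xia)).
  rewrite (opX_power_branch (hP xi xia) Ow (hg k xi w xia Ow)).
  rewrite (opX_sum a k oOmega _ Ow (fun q => dT xi q xia)).
  have -> : \sum_(1 <= q < (eps xi).+1 | (0 < q < (eps xi).+1)%N) opX a k (T xi q) w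
      = \sum_(1 <= q < (eps xi).+1) mu k q xi * h q xi.
    rewrite [RHS]big_nat_cond; apply: eq_big => q; first by rewrite andbT.
    move=> qe; have [dq muq] := hPsi xi q xia qe.
    by rewrite (opX_scale a k oOmega _ Ow dq) muq // mulrC.
  rewrite /c /F; move: (\sum_(_ <= _ < _) _) (P xi w) (cexp _) => s p e.
  by move: (lambda k xi) (h 0%N xi) => l h0; ring.
by rewrite (opX_prod_eigen oOmega _ Ow dF Fc) (hh k) mul0r.
Qed.

End FirstIntegral.

Theorem theorem1p2 (R : realType) (m n : nat) (hm : (1 <= m)%N) (hn : (1 <= n)%N)
  (a : 'I_n -> 'I_(m + m) -> 'cV[R[i]]_(n + n))
  (hsolv : completely_solvable a)
  (zeta : 'I_m)
  (hzeta : forall j : 'I_m,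
     (size (elementary_divisors (matA a (lshift m zeta))) <=
      size (elementary_divisors (matA a (lshift m j))))%N)
  (r : nat) (hr : (1 <= r)%N)
  (s : 'I_r -> nat)
  (nu : nat -> 'I_r -> 'cV[R[i]]_(n + n))
  (lambda : 'I_(m + m) -> 'I_r -> R[i])
  (hnu0 : forall l, nu 0%N l != 0)
  (heigen : forall l k, matA a k *m nu 0%N l = lambda k l *: nu 0%N l)
  (hs : forall l, (2 <= s l)%N)
  (heldiv : forall l, (lambda (lshift m zeta) l, s l)
     \in elementary_divisors (matA a (lshift m zeta)))
  (hgen : forall l eta, (1 <= eta <= s l - 1)%N ->
     nu eta l != 0 /\
     (matA a (lshift m zeta) - (lambda (lshift m zeta) l)%:M) *m nu eta l
       = eta%:R *: nu (eta - 1)%N l)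
  (hsum : (2 * m + 1 <= \sum_(l < r) s l)%N)
  (Omega : set 'cV[R[i]]_n) (hOmega : is_domain Omega)
  (hOmega0 : forall l w, Omega w -> lin_form (nu 0%N l) w <> 0)
  (Psi : nat -> 'I_r -> 'cV[R[i]]_n -> R[i])
  (hPsi : forall l eta, (1 <= eta <= s l - 1)%N -> forall w, Omega w ->
     lin_form (nu eta l) w =
       \sum_(1 <= delta < eta.+1)
         ('C(eta - 1, delta - 1))%:R * Psi delta l w
           * lin_form (nu (eta - delta)%N l) w)
  (hnofi : forall k l eta, k <> lshift m zeta -> (1 <= eta <= s l - 1)%N ->
     ~ ode_first_integral a zeta Omega (opX a k (Psi eta l))) :
  exists mu : 'I_(m + m) -> nat -> 'I_r -> R[i],
  [/\ forall k l eta, (1 <= eta <= s l - 1)%N -> forall w, Omega w ->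
        opX a k (Psi eta l) w = mu k eta l,
      exists (alpha : nat) (eps : 'I_r -> nat),
        [/\ (alpha <= r)%N,
            forall xi : 'I_r, (xi < alpha)%N -> (eps xi <= s xi - 1)%N
          & (\sum_(xi < r | (xi < alpha)%N) eps xi + alpha = 2 * m + 1)%N]
    & forall (alpha : nat) (eps : 'I_r -> nat),
        (alpha <= r)%N ->
        (forall xi : 'I_r, (xi < alpha)%N -> (eps xi <= s xi - 1)%N) ->
        (\sum_(xi < r | (xi < alpha)%N) eps xi + alpha = 2 * m + 1)%N ->
        let nontrivial_solution (h : nat -> 'I_r -> R[i]) :=
          (exists (xi : 'I_r) (q : nat),
             [/\ (xi < alpha)%N, (q <= eps xi)%N & h q xi <> 0]) /\
          (forall k, \sum_(xi < r | (xi < alpha)%N)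
             (lambda k xi * h 0%N xi
              + \sum_(1 <= q < (eps xi).+1) mu k q xi * h q xi) = 0) in
        (exists h, nontrivial_solution h) /\
        forall h, nontrivial_solution h ->
          forall P : 'I_r -> 'cV[R[i]]_n -> R[i],
            (forall xi : 'I_r, (xi < alpha)%N ->
               power_branch Omega (lin_form (nu 0%N xi)) (h 0%N xi) (P xi)) ->
            autonomous_first_integral a Omega
              (fun w => \prod_(xi < r | (xi < alpha)%N)
                 (P xi w * cexp (\sum_(1 <= q < (eps xi).+1)
                                   h q xi * Psi q xi w)))].
Proof.
have [oOmega _] := hOmega.
pose z := lshift m zeta.
have nu0_neq0 l w (Ow : Omega w) : lin_form (nu 0%N l) w != 0.
  by apply/eqP; exact: hOmega0.
have chainS l p : (p < s l - 1)%N -> matA a z *m nu p.+1 l =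
    lambda z l *: nu p.+1 l + p.+1%:R *: nu p l.
  move=> pS; have [_ e] := hgen l p.+1 pS; rewrite subn1 /= in e.
  by rewrite -e mulmxBl mul_scalar_mx addrC subrK.
have PsiE l p : (p < s l - 1)%N -> forall w, Omega w ->
    lin_form (nu p.+1 l) w = \sum_(d < p.+1)
      'C(p, d)%:R * Psi d.+1 l w * lin_form (nu (p - d)%N l) w.
  move=> pS w Ow; rewrite (hPsi l p.+1 pS w Ow) big_add1 /= big_mkord.
  by apply: eq_bigr => d _; rewrite !subn1 /= subSS.
have rPsi l eta : (1 <= eta <= s l - 1)%N -> rational_on Omega (Psi eta l).
  case: eta => // p pS.
  exact: (@chain_quotient_rational _ _ Omega (fun p => nu p l) (s l - 1) (fun d => Psi d.+1 l)
    (nu0_neq0 l) (PsiE l) p pS).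
have zPsi l eta : (1 <= eta <= s l - 1)%N -> forall w, Omega w ->
    opX a z (Psi eta l) w = (eta == 1%N)%:R.
  case: eta => // p pS w Ow.
  exact: (@opX_chain_quotient _ _ _ a _ oOmega z (lambda z l) (fun p => nu p l)
    (s l - 1) (fun d => Psi d.+1 l)
    (heigen l z) (chainS l) (nu0_neq0 l) (PsiE l) p w pS Ow).
have const k l eta : (1 <= eta <= s l - 1)%N ->
    exists c, forall w, Omega w -> opX a k (Psi eta l) w = c.
  move=> etaS; have [->|kz] := pselect (k = z).
    by exists (eta == 1%N)%:R; exact: zPsi.
  exact: (opX_const_of_not_first_integral oOmega hsolv (rPsi l eta etaS)
    (zPsi l eta etaS) (hnofi k l eta kz etaS)).
(* On an empty Omega every number qualifies; otherwise there is exactly one. *)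
pose value k eta l := [set c | forall w, Omega w -> opX a k (Psi eta l) w = c].
pose mu k eta l := xget 0 (value k eta l).
have muE k l eta : (1 <= eta <= s l - 1)%N -> forall w, Omega w ->
    opX a k (Psi eta l) w = mu k eta l.
  by case/(const k) => c cE; exact: (@xgetI _ 0 (value k eta l) c cE).
exists mu; split; first exact: muE.
  apply: exists_exponents; last by [].
  by move=> l; apply: leq_trans (hs l).
move=> alpha eps ar hbound hcount nontrivial_solution; split.
  apply: nontrivial_exponents => //.
  by rewrite hcount mul2n addnn addn1.
move=> h [_ hh] P hP.
apply: (autonomous_first_integral_prod oOmega (lambda := lambda) (mu := mu)
  (g := fun xi => lin_form (nu 0%N xi))) => //.
- by move=> k xi w _ _; rewrite opX_lin_form heigen lin_formZ.
- move=> xi q xia qe; have qS : (1 <= q <= s xi - 1)%N.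
    by move: qe; rewrite ltnS => /andP[-> /leq_trans]; apply; exact: hbound.
  split; first exact: (rational_Rdifferentiable oOmega (rPsi xi q qS)).
  by move=> k; exact: muE.
Qed.
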